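(* Let $\mathcal{A}$ be an additive Hom-finite Krull-Schmidt $k$-category for which there is a positive integer $n\ge 2$ such that each indecomposable object of $\mathbf{C}^b(\mathcal{A})$ is a shift of an indecomposable object of $\mathbf{C}_{[1,n]}(\mathcal{A})$. Let $m$ be a positive integer. For every indecomposable $Z\in\mathbf{C}_{\equiv m}(\mathcal{A})$ there are an indecomposable $\widehat{Z}\in\mathbf{C}_{[1,n]}(\mathcal{A})$ and an integer $t\in\{0,\dots,m-1\}$ such that $Z\cong\mathcal{F}_m(\widehat{Z}[t])$. In particular, the compression functor $\mathcal{F}_m:\mathbf{C}^b(\mathcal{A})\to\mathbf{C}_{\equiv m}(\mathcal{A})$ is dense.
   Context: $k$ is a commutative ring. $\mathbf{C}^b(\mathcal{A})$ is the category of bounded cochain complexes over $\mathcal{A}$; $\mathbf{C}_{[1,n]}(\mathcal{A})$ is the full subcategory of complexes with $X^i=0$ for $i\notin[1,n]$. The shift $X[t]$ has $X[t]^i=X^{i+t}$ and differential $(-1)^td_X^{i+t}$. $\mathbf{C}_{\equiv m}(\mathcal{A})$ is the category of $m$-periodic complexes: complexes $X=(X^i,d_X^i)_{i\in\mathbb{Z}}$ with $X^i=X^j$ and $d_X^i=d_X^j$ whenever $i\equiv j\pmod m$; morphisms are chain maps $(f^i)$ with $f^i=f^j$ whenever $i\equiv j\pmod m$. The compression functor $\mathcal{F}_m$ is given by $\mathcal{F}_m(X)^i=\bigoplus_{t\in\mathbb{Z}}X^{i+tm}$ with diagonal differential with components $d_X^{i+tm}$, and $\mathcal{F}_m(f)^i$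 is diagonal with components $f^{i+tm}$. *)

(* Defs.v *)
From HB Require Import structures.
From mathcomp Require Import all_boot all_order all_algebra.
From mathcomp Require Import finmap.
From mathcomp Require Import boolp classical_sets functions cardinality fsbigop.
From mathcomp Require Import zify.

Set Implicit Arguments.
Unset Strict Implicit.
Unset Printing Implicit Defensive.
Import Order.TTheory GRing.Theory Num.Theory.
Local Open Scope ring_scope.

Record kcat (k : comPzRingType) := KCat {
  obj :> Type;
  hom : obj -> obj -> lmodType k;
  idm : forall X, hom X X;
  comp : forall X Y Z, hom Y Z -> hom X Y -> hom X Z;
  comp1m : forall X Y (f : hom X Y), comp (idm Y) f = f;
  compm1 : forall X Y (f : hom X Y), comp f (idm X) = f;
  compA : forall X Y Z T (h : hom Z T) (g : hom Y Z) (f : hom X Y),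
    comp h (comp g f) = comp (comp h g) f;
  comp_linl : forall X Y Z (a : k) (g g' : hom Y Z) (f : hom X Y),
    comp (a *: g + g') f = a *: comp g f + comp g' f;
  comp_linr : forall X Y Z (a : k) (g : hom Y Z) (f f' : hom X Y),
    comp g (a *: f + f') = a *: comp g f + comp g f' }.

Arguments hom {k A} X Y : rename.
Arguments idm {k A} X : rename.

Declare Scope kcat_scope.
Delimit Scope kcat_scope with kcat.
Local Open Scope kcat_scope.
Notation "g \oc f" := (comp g f) (at level 40, left associativity) : kcat_scope.

Section Category.
Variables (k : comPzRingType) (A : kcat k).
Implicit Types X Y : A.

Definition is_zero X :=
  (forall Y (f : hom X Y), f = 0) /\ (forall Y (f : hom Y X), f = 0).

Definition is_iso X Y (f : hom X Y) :=
  exists g : hom Y X, g \oc f = idm X /\ f \oc g = idm Y.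

Definition isomorphic X Y := exists f : hom X Y, is_iso f.

(** [dsum F X] is the type of structures of direct sum of the family [F] on
    [X].  The index type may be infinite; the last equation then forces all but
    finitely many of the [F i] to be zero objects ([\sum_(i \in _)] is the sum
    over the support, with value [0] if the support is infinite). *)
Record dsum (I : choiceType) (F : I -> A) (X : A) := DSum {
  inj : forall i, hom (F i) X;
  prj : forall i, hom X (F i);
  prj_inj : forall i, prj i \oc inj i = idm (F i);
  prj_inj0 : forall i j, i != j -> prj j \oc inj i = 0;
  sum_inj_prj : \sum_(i \in [set: I]) inj i \oc prj i = idm X }.

Definition is_additive :=
  forall (I : finType) (F : I -> A), exists X, inhabited (dsum F X).

Definition indecomposable X :=
  ~ is_zero X /\
  forall F : bool -> A, dsum F X -> is_zero (F true) \/ is_zero (F false).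

Definition local_end X :=
  idm X <> 0 /\
  forall f g : hom X X, ~ is_iso f -> ~ is_iso g -> ~ is_iso (f + g).

Definition krull_schmidt :=
  forall X, exists (n : nat) (F : 'I_n -> A),
    inhabited (dsum F X) /\ forall i, local_end (F i).

End Category.

Arguments is_iso {k A X Y} f.
Arguments isomorphic {k A} X Y.
Arguments is_additive {k} A.
Arguments krull_schmidt {k} A.

Notation "X ~=~ Y" := (isomorphic X Y) (at level 70) : kcat_scope.

(** Over a commutative ring [k], Hom-finiteness means that the [hom X Y] are
    [k]-modules of finite length, i.e. have a composition series. *)
Definition finite_length (k : comPzRingType) (V : lmodType k) :=
  exists (n : nat) (M : nat -> {pred V}),
    [/\ forall i, GRing.submod_closed (M i),
        M 0%N =i pred1 0, M n =i predT &
        forall i, (i < n)%N ->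
          [/\ {subset M i <= M i.+1}, ~ (M i =i M i.+1) &
              forall N : {pred V}, GRing.submod_closed N ->
                {subset M i <= N} -> {subset N <= M i.+1} ->
                N =i M i \/ N =i M i.+1]].

Definition hom_finite (k : comPzRingType) (A : kcat k) :=
  forall X Y : A, finite_length (hom X Y).

Definition full_sub (k : comPzRingType) (A : kcat k) (P : A -> Prop) : kcat k :=
  @KCat k {X : A | P X} (fun X Y => hom (sval X) (sval Y))
    (fun X => idm (sval X)) (fun X Y Z g f => g \oc f)
    (fun X Y f => comp1m f) (fun X Y f => compm1 f)
    (fun X Y Z T h g f => compA h g f)
    (fun X Y Z a g g' f => comp_linl a g g' f)
    (fun X Y Z a g f f' => comp_linr a g f f').

Record functor (k : comPzRingType) (A B : kcat k) := Functor {
  fobj :> A -> B;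
  fmor : forall X Y : A, hom X Y -> hom (fobj X) (fobj Y);
  fmor1 : forall X : A, fmor (idm X) = idm (fobj X);
  fmorM : forall (X Y Z : A) (g : hom Y Z) (f : hom X Y),
    fmor (g \oc f) = fmor g \oc fmor f;
  fmor_lin : forall (X Y : A) (a : k) (f g : hom X Y),
    fmor (a *: f + g) = a *: fmor f + fmor g }.

Definition is_dense (k : comPzRingType) (A B : kcat k) (F : functor A B) :=
  forall Y : B, exists X : A, F X ~=~ Y.

Section CategoryTheory.
Variables (k : comPzRingType) (A : kcat k).

Lemma compDl (X Y Z : A) (g g' : hom Y Z) (f : hom X Y) :
  (g + g') \oc f = g \oc f + g' \oc f.
Proof. by have := comp_linl 1 g g' f; rewrite !scale1r. Qed.

Lemma compDr (X Y Z : A) (g : hom Y Z) (f f' : hom X Y) :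
  g \oc (f + f') = g \oc f + g \oc f'.
Proof. by have := comp_linr 1 g f f'; rewrite !scale1r. Qed.

Lemma comp0m (X Y Z : A) (f : hom X Y) : (0 : hom Y Z) \oc f = 0.
Proof. by apply: (addrI (0 \oc f)); rewrite -compDl !addr0. Qed.

Lemma compm0 (X Y Z : A) (g : hom Y Z) : g \oc (0 : hom X Y) = 0.
Proof. by apply: (addrI (g \oc 0)); rewrite -compDr !addr0. Qed.

Lemma compZl (X Y Z : A) a (g : hom Y Z) (f : hom X Y) :
  (a *: g) \oc f = a *: (g \oc f).
Proof. by have := comp_linl a g 0 f; rewrite comp0m !addr0. Qed.

Lemma compZr (X Y Z : A) a (g : hom Y Z) (f : hom X Y) :
  g \oc (a *: f) = a *: (g \oc f).
Proof. by have := comp_linr a g f 0; rewrite compm0 !addr0. Qed.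

Lemma comp_suml (X Y Z : A) (I : Type) (s : seq I) (P : pred I)
    (g : I -> hom Y Z) (f : hom X Y) :
  (\sum_(i <- s | P i) g i) \oc f = \sum_(i <- s | P i) g i \oc f.
Proof.
by elim/big_rec2: _ => [|i u v _ <-]; rewrite ?comp0m ?compDl.
Qed.

Lemma comp_sumr (X Y Z : A) (I : Type) (s : seq I) (P : pred I)
    (g : hom Y Z) (f : I -> hom X Y) :
  g \oc (\sum_(i <- s | P i) f i) = \sum_(i <- s | P i) g \oc f i.
Proof.
by elim/big_rec2: _ => [|i u v _ <-]; rewrite ?compm0 ?compDr.
Qed.

Lemma fsum_seq (V : zmodType) (I : choiceType) (s : seq I) (f : I -> V) :
  uniq s -> (forall i, i \notin s -> f i = 0) ->
  \sum_(i \in [set: I]) f i = \sum_(i <- s) f i.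
Proof.
move=> us fs; rewrite (@fsbigTE _ _ _ _ [fset x in s]%fset).
  by apply: perm_big; apply: uniq_perm => // x; rewrite inE.
by move=> i; rewrite !inE; exact: fs.
Qed.

Lemma dsum_fin (I : choiceType) (F : I -> A) X (D : dsum F X) :
  exists s : seq I, [/\ uniq s, forall i, i \notin s -> inj D i = 0,
    forall i, i \notin s -> prj D i = 0 &
    \sum_(i <- s) inj D i \oc prj D i = idm X].
Proof.
pose s := finite_support 0 [set: I] (fun i => inj D i \oc prj D i).
have us : uniq s by exact: finite_support_uniq.
have e1 : \sum_(i <- s) inj D i \oc prj D i = idm X := sum_inj_prj D.
exists s; split => // i Ni.
- rewrite -[inj D i]comp1m -e1 comp_suml big_seq big1 // => j js.
  rewrite -compA prj_inj0 ?compm0 //; apply: contraNneq Ni => ->; exact: js.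
- rewrite -[prj D i]compm1 -e1 comp_sumr big_seq big1 // => j js.
  rewrite compA prj_inj0 ?comp0m //; apply: contraNneq Ni => <-; exact: js.
Qed.

(** The morphism of direct sums with a given matrix of components, and its
    variant for diagonal matrices. *)
Definition mxm (I J : choiceType) (F : I -> A) (G : J -> A) (X Y : A)
    (D : dsum F X) (E : dsum G Y) (M : forall i j, hom (F i) (G j)) : hom X Y :=
  \sum_(j \in [set: J]) \sum_(i \in [set: I]) inj E j \oc M i j \oc prj D i.

Definition diagm (I : choiceType) (F G : I -> A) (X Y : A)
    (D : dsum F X) (E : dsum G Y) (g : forall i, hom (F i) (G i)) : hom X Y :=
  \sum_(i \in [set: I]) inj E i \oc g i \oc prj D i.

Lemma mxmE (I J : choiceType) (F : I -> A) (G : J -> A) X Y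
    (D : dsum F X) (E : dsum G Y) (M : forall i j, hom (F i) (G j)) i j :
  prj E j \oc mxm D E M \oc inj D i = M i j.
Proof.
have [s [us is0 ps0 _]] := dsum_fin D.
have [r [ur ir0 pr0 _]] := dsum_fin E.
have -> : mxm D E M =
    \sum_(j <- r) \sum_(i <- s) inj E j \oc M i j \oc prj D i.
  rewrite /mxm (@fsum_seq _ _ r) //; last first.
    move=> l Nl; rewrite (@fsum_seq _ _ [::]) ?big_nil // => a _.
    by rewrite ir0 // !comp0m.
  apply: eq_bigr => l _; rewrite (@fsum_seq _ _ s) // => a Na.
  by rewrite ps0 // compm0.
case: (boolP (j \in r)) => [jr|Nj]; last first.
  by rewrite -(comp1m (M i j)) -(prj_inj E) ir0 // pr0 // !comp0m.
case: (boolP (i \in s)) => [ii|Ni]; last first.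
  by rewrite -(compm1 (M i j)) -(prj_inj D) is0 // !compm0.
rewrite comp_sumr comp_suml (bigD1_seq j) //= [X in _ + X]big1 ?addr0.
  rewrite comp_sumr comp_suml (bigD1_seq i) //= [X in _ + X]big1 ?addr0.
    by rewrite !compA prj_inj comp1m -compA prj_inj compm1.
  by move=> a ai; rewrite -!compA prj_inj0 1?eq_sym // !compm0.
move=> l lj; rewrite comp_sumr comp_suml big1 // => a _.
by rewrite !compA prj_inj0 // !comp0m.
Qed.

Lemma diagm_inj (I : choiceType) (F G : I -> A) X Y
    (D : dsum F X) (E : dsum G Y) (g : forall i, hom (F i) (G i)) i :
  diagm D E g \oc inj D i = inj E i \oc g i.
Proof.
have [s [us is0 ps0 _]] := dsum_fin D.
have -> : diagm D E g = \sum_(i <- s) inj E i \oc g i \oc prj D i.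
  by rewrite /diagm (@fsum_seq _ _ s) // => a Na; rewrite ps0 // compm0.
case: (boolP (i \in s)) => [ii|Ni]; last first.
  by rewrite -(compm1 (g i)) -(prj_inj D) is0 // !compm0.
rewrite comp_suml (bigD1_seq i) //= [X in _ + X]big1 ?addr0.
  by rewrite -compA prj_inj compm1.
by move=> a ai; rewrite -!compA prj_inj0 1?eq_sym // !compm0.
Qed.

Lemma prj_diagm (I : choiceType) (F G : I -> A) X Y
    (D : dsum F X) (E : dsum G Y) (g : forall i, hom (F i) (G i)) i :
  prj E i \oc diagm D E g = g i \oc prj D i.
Proof.
have [s [us is0 ps0 _]] := dsum_fin D.
have -> : diagm D E g = \sum_(i <- s) inj E i \oc g i \oc prj D i.
  by rewrite /diagm (@fsum_seq _ _ s) // => a Na; rewrite ps0 // compm0.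
case: (boolP (i \in s)) => [ii|Ni]; last first.
  rewrite ps0 // compm0 comp_sumr big_seq big1 // => a ai.
  rewrite !compA prj_inj0 ?comp0m //; apply: contraNneq Ni => <-; exact: ai.
rewrite comp_sumr (bigD1_seq i) //= [X in _ + X]big1 ?addr0.
  by rewrite !compA prj_inj comp1m.
by move=> a ai; rewrite !compA prj_inj0 // !comp0m.
Qed.

Lemma dsum_extr (I : choiceType) (F : I -> A) X Y (D : dsum F X)
    (f g : hom X Y) :
  (forall i, f \oc inj D i = g \oc inj D i) -> f = g.
Proof.
move=> fg; have [s [us is0 ps0 e1]] := dsum_fin D.
rewrite -(compm1 f) -(compm1 g) -e1 !comp_sumr.
by apply: eq_bigr => i _; rewrite !compA fg.
Qed.

Lemma dsum_extl (I : choiceType) (F : I -> A) X Y (D : dsum F X)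
    (f g : hom Y X) :
  (forall i, prj D i \oc f = prj D i \oc g) -> f = g.
Proof.
move=> fg; have [s [us is0 ps0 e1]] := dsum_fin D.
rewrite -(comp1m f) -(comp1m g) -e1 !comp_suml.
by apply: eq_bigr => i _; rewrite -!compA fg.
Qed.

Lemma mxm0 (I J : choiceType) (F : I -> A) (G : J -> A) X Y
    (D : dsum F X) (E : dsum G Y) (M : forall i j, hom (F i) (G j)) :
  (forall i j, M i j = 0) -> mxm D E M = 0.
Proof.
move=> M0; apply: (dsum_extr (D := D)) => i; apply: (dsum_extl (D := E)) => j.
by rewrite compA mxmE M0 comp0m compm0.
Qed.

Lemma mxm_comp0 (I J L : choiceType) (F : I -> A) (G : J -> A) (H : L -> A)
    X Y Z (D : dsum F X) (E : dsum G Y) (K : dsum H Z)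
    (M : forall i j, hom (F i) (G j)) (N : forall i j, hom (G i) (H j)) :
  (forall i j l, N j l \oc M i j = 0) -> mxm E K N \oc mxm D E M = 0.
Proof.
move=> NM; apply: (dsum_extr (D := D)) => i; apply: (dsum_extl (D := K)) => l.
have [s [us is0 ps0 e1]] := dsum_fin E.
have comp_split W W' (g : hom Y W') (f : hom W Y) :
    g \oc f = \sum_(j <- s) (g \oc inj E j) \oc (prj E j \oc f).
  rewrite -[in LHS](comp1m f) -e1 comp_suml comp_sumr.
  by apply: eq_bigr => j _; rewrite -!compA.
rewrite comp0m compm0.
transitivity ((prj K l \oc mxm E K N) \oc (mxm D E M \oc inj D i)).
  by rewrite !compA.
by rewrite comp_split big1 // => j _; rewrite mxmE (compA (prj E j)) mxmE NM.
Qed.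

Lemma dsum_exists (I : choiceType) (F : I -> A) (s : seq I) :
  is_additive A -> (forall i, i \notin s -> is_zero (F i)) ->
  exists X, inhabited (dsum F X).
Proof.
move=> addA Fs.
have [X [D]] := addA (seq_sub s) (fun x => F (ssval x)).
pose ii i : hom (F i) X :=
  if pselect (i \in s) is left h then inj D (SeqSub h) else 0.
pose pp i : hom X (F i) :=
  if pselect (i \in s) is left h then prj D (SeqSub h) else 0.
exists X; constructor; apply: (@DSum _ _ _ _ _ ii pp).
- move=> i; rewrite /ii /pp; case: pselect => [h|/negP h].
    by rewrite (prj_inj D (SeqSub h)).
  by rewrite (proj1 (Fs i h) _ (idm (F i))) compm0.
- move=> i j ij; rewrite /ii /pp.
  case: pselect => hj; last by rewrite comp0m.
  case: pselect => hi; last by rewrite compm0.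
  by apply: (@prj_inj0 _ _ _ _ _ D (SeqSub hi) (SeqSub hj)); rewrite -val_eqE.
- rewrite (@fsum_seq _ _ (undup s)) ?undup_uniq //; last first.
    move=> i; rewrite mem_undup => h; rewrite /ii.
    by case: pselect => h'; [rewrite h' in h|rewrite comp0m].
  rewrite -(sum_inj_prj D) (@fsum_seq _ _ (index_enum (seq_sub s))); last first.
  + by move=> i; rewrite mem_index_enum.
  + exact: index_enum_uniq.
  rewrite [RHS](eq_bigr (fun x : seq_sub s => ii (val x) \oc pp (val x))).
    rewrite -(big_map val predT (fun i => ii i \oc pp i)); apply: perm_big.
    apply: uniq_perm; rewrite ?undup_uniq ?(map_inj_uniq val_inj) ?index_enum_uniq //.
    move=> i; rewrite mem_undup; apply/idP/mapP => [h|[x _ ->]].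
      by exists (SeqSub h); rewrite ?mem_index_enum.
    exact: ssvalP.
  move=> [x hx] _; rewrite /ii /pp /=.
  case: pselect => h; last by rewrite hx in h.
  by rewrite (bool_irrelevance h hx).
Qed.

End CategoryTheory.

(** Complexes are indexed by a type [I] with a boolean relation [r], [r i j]
    meaning that [j] is the successor of [i].  The differential is given for
    all pairs of indices and vanishes when [~~ r i j]; this avoids transporting
    morphisms along equalities such as [i + 1 + t = i + t + 1]. *)

Section Complexes.
Variables (k : comPzRingType) (A : kcat k) (I : Type) (r : rel I).

Record complex := Complex {
  cobj :> I -> A;
  diff : forall i j, hom (cobj i) (cobj j);
  diff_shape : forall i j, ~~ r i j -> diff i j = 0;
  diff_diff : forall i j l, diff j l \oc diff i j = 0 }.

Record chmap (X Y : complex) := ChMap {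
  chm :> forall i, hom (X i) (Y i);
  chmP : forall i j, diff Y i j \oc chm i = chm j \oc diff X i j }.

Lemma chmap_ext X Y (f g : chmap X Y) : (forall i, f i = g i) -> f = g.
Proof.
case: f g => [f fP] [g gP] /= fg; have efg : f = g by apply: functional_extensionality_dep.
by case: _ / efg in gP *; congr ChMap; exact: Prop_irrelevance.
Qed.

Section Hom.
Variables X Y : complex.

HB.instance Definition _ := gen_eqMixin (chmap X Y).
HB.instance Definition _ := gen_choiceMixin (chmap X Y).

Definition chm0 : chmap X Y.
Proof. by exists (fun i => 0) => i j; rewrite comp0m compm0. Defined.

Definition chm_add (f g : chmap X Y) : chmap X Y.
Proof. by exists (fun i => f i + g i) => i j; rewrite compDl compDr !chmP. Defined.

Definition chm_scale (a : k) (f : chmap X Y) : chmap X Y.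
Proof. by exists (fun i => a *: f i) => i j; rewrite compZl compZr chmP. Defined.

Definition chm_opp (f : chmap X Y) : chmap X Y.
Proof.
by exists (fun i => - f i) => i j; rewrite -!scaleN1r compZl compZr chmP.
Defined.

Fact chm_addA : associative chm_add.
Proof. by move=> f g h; apply: chmap_ext => i; exact: addrA. Qed.
Fact chm_addC : commutative chm_add.
Proof. by move=> f g; apply: chmap_ext => i; exact: addrC. Qed.
Fact chm_add0 : left_id chm0 chm_add.
Proof. by move=> f; apply: chmap_ext => i; exact: add0r. Qed.
Fact chm_addN : left_inverse chm0 chm_opp chm_add.
Proof. by move=> f; apply: chmap_ext => i; exact: addNr. Qed.

HB.instance Definition _ := GRing.isZmodule.Build (chmap X Y)
  chm_addA chm_addC chm_add0 chm_addN.

Fact chm_scaleA a b f : chm_scale a (chm_scale b f) = chm_scale (a * b) f.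
Proof. by apply: chmap_ext => i; exact: scalerA. Qed.
Fact chm_scale1 : left_id 1 chm_scale.
Proof. by move=> f; apply: chmap_ext => i; exact: scale1r. Qed.
Fact chm_scaleDr : right_distributive chm_scale +%R.
Proof. by move=> a f g; apply: chmap_ext => i; exact: scalerDr. Qed.
Fact chm_scaleDl f : {morph chm_scale^~ f : a b / a + b}.
Proof. by move=> a b; apply: chmap_ext => i; exact: scalerDl. Qed.

HB.instance Definition _ := GRing.Zmodule_isLmodule.Build k (chmap X Y)
  chm_scaleA chm_scale1 chm_scaleDr chm_scaleDl.

End Hom.

Definition chm_id (X : complex) : chmap X X.
Proof. by exists (fun i => idm (X i)) => i j; rewrite comp1m compm1. Defined.

Definition chm_comp (X Y Z : complex) (g : chmap Y Z) (f : chmap X Y) : chmap X Z.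
Proof.
by exists (fun i => g i \oc f i) => i j; rewrite compA chmP -compA chmP compA.
Defined.

Definition complexes : kcat k.
Proof.
refine (@KCat k complex (fun X Y => chmap X Y : lmodType k) chm_id chm_comp
  _ _ _ _ _).
- by move=> X Y f; apply: chmap_ext => i; exact: comp1m.
- by move=> X Y f; apply: chmap_ext => i; exact: compm1.
- by move=> X Y Z T h g f; apply: chmap_ext => i; exact: compA.
- by move=> X Y Z a g g' f; apply: chmap_ext => i; exact: comp_linl.
- by move=> X Y Z a g f f'; apply: chmap_ext => i; exact: comp_linr.
Defined.

End Complexes.

Arguments Complex {k A I r} cobj diff diff_shape diff_diff.
Arguments ChMap {k A I r X Y} chm chmP.

Definition succz : rel int := fun i j => j == i + 1.

(** The index [i : 'I_m] stands for its residue class modulo [m]; [ordS] is the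
    successor in [Z/m].  An [m]-periodic complex is determined by its
    restriction to [0, ..., m-1]. *)
Definition succm (m : nat) : rel 'I_m := fun i j => j == ordS i.

Section Bounded.
Variables (k : comPzRingType) (A : kcat k).

Definition bounded (X : complex A succz) :=
  exists N : nat, forall i : int, (N < `|i|)%N -> is_zero (X i).

Definition Cb : kcat k := full_sub (A := complexes A succz) bounded.

Definition bcomplex (X : Cb) : complex A succz := sval X.

Definition C1 (n : nat) : kcat k :=
  full_sub (A := Cb) (fun X => forall i : int,
    ~~ ((1 <= i) && (i <= n%:Z)) -> is_zero (bcomplex X i)).

Definition C1_incl (n : nat) (X : C1 n) : Cb := sval X.

Definition Cper (m : nat) : kcat k := complexes A (@succm m).

Definition cshift (t : int) (X : complex A succz) : complex A succz.
Proof.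
refine (Complex (fun i => X (i + t))
  (fun i j => (-1) ^+ `|t|%N *: diff X (i + t) (j + t)) _ _).
- move=> i j ij; rewrite diff_shape ?scaler0 //; move: ij; rewrite /succz.
  by apply: contraNN => /eqP e; apply/eqP; lia.
- by move=> i j l; rewrite compZl compZr diff_diff !scaler0.
Defined.

Lemma cshift_bounded t X : bounded X -> bounded (cshift t X).
Proof.
move=> [N XN]; exists (N + `|t|)%N => i iN; apply: XN; lia.
Qed.

Definition shift (t : int) (X : Cb) : Cb :=
  exist _ (cshift t (bcomplex X)) (cshift_bounded t (svalP X)).

End Bounded.

Arguments bcomplex {k A} X.
Arguments C1_incl {k A n} X.
Arguments shift {k A} t X.

Section Compression.
Variables (k : comPzRingType) (A : kcat k) (addA : is_additive A) (m : nat).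

Lemma compression_dsum_exists (X : Cb A) (i : 'I_m) :
  exists S, inhabited (dsum (fun t : int => bcomplex X (i%:Z + t * m%:Z)) S).
Proof.
have [N XN] := svalP X.
pose s : seq int := [seq j%:Z - (N + m)%:Z | j <- iota 0 (N + m + N + m).+1].
apply: (@dsum_exists _ _ _ _ s addA) => t ts; apply: XN.
have im := ltn_ord i; rewrite ltnNge; apply/negP => tN; case/negP: ts.
have tb : (`|t| <= N + m)%N by nia.
apply/mapP; exists `|(t + (N + m)%:Z : int)%R|%N; last by lia.
by rewrite mem_iota; lia.
Qed.

(** A choice of [\bigoplus_(t in Z) X^(i + t m)]. *)
Definition compression_obj (X : Cb A) (i : 'I_m) : A :=
  projT1 (cid (compression_dsum_exists X i)).

Definition compression_dsum (X : Cb A) (i : 'I_m) :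
    dsum (fun t : int => bcomplex X (i%:Z + t * m%:Z)) (compression_obj X i) :=
  inhabited_witness (projT2 (cid (compression_dsum_exists X i))).

(** The component from [X^(i + t m)] to [X^(j + u m)] is [d_X] if the latter
    degree is the successor of the former, and [0] otherwise; so [u = t], except
    that [u = t + 1] for [i = m - 1] and [j = 0]. *)
Definition compression_diff (X : Cb A) (i j : 'I_m) :
    hom (compression_obj X i) (compression_obj X j) :=
  mxm (compression_dsum X i) (compression_dsum X j)
    (fun t u => diff (bcomplex X) (i%:Z + t * m%:Z) (j%:Z + u * m%:Z)).

Definition compression_complex (X : Cb A) : Cper A m.
Proof.
refine (Complex (compression_obj X) (compression_diff X) _ _).
- move=> i j ij; apply: mxm0 => t u; apply: diff_shape.
  apply: contraNN ij => /eqP e; apply/eqP/val_inj => /=.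
  have e' : (j%:Z + u * m%:Z = i.+1%:Z + t * m%:Z) by lia.
  have := congr1 (fun x => (x %% m%:Z)%Z) e'.
  rewrite !(addrC _ (_ * _)) !modzMDl !modz_nat => -[<-].
  by rewrite modn_small.
- by move=> i j l; apply: mxm_comp0 => t u v; exact: diff_diff.
Defined.

Definition compression_map (X Y : Cb A) (f : hom X Y) :
  hom (compression_complex X) (compression_complex Y).
Proof.
refine (ChMap (X := compression_complex X) (Y := compression_complex Y)
  (fun i => diagm (compression_dsum X i) (compression_dsum Y i)
    (fun t => chm f (i%:Z + t * m%:Z))) _).
move=> i j /=.
apply: (dsum_extr (D := compression_dsum X i)) => t.
apply: (dsum_extl (D := compression_dsum Y j)) => u.
pose DX := compression_dsum X; pose DY := compression_dsum Y.
rewrite -(compA (compression_diff Y i j)) (diagm_inj (DX i)) !compA.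
rewrite (mxmE (DY i) (DY j)) (prj_diagm (DX j) (DY j)).
rewrite -!compA (compA (prj (DX j) u)) (mxmE (DX i) (DX j)); exact: chmP.
Defined.

Definition compression : functor (Cb A) (Cper A m).
Proof.
refine (@Functor k (Cb A) (Cper A m) compression_complex compression_map _ _ _).
- move=> X; apply: chmap_ext => i /=.
  apply: (dsum_extr (D := compression_dsum X i)) => t.
  by rewrite (diagm_inj (compression_dsum X i)) compm1 comp1m.
- move=> X Y Z g f; apply: chmap_ext => i /=.
  apply: (dsum_extr (D := compression_dsum X i)) => t.
  rewrite (diagm_inj (compression_dsum X i)) -compA.
  rewrite (diagm_inj (compression_dsum X i)) !compA.
  by rewrite (diagm_inj (compression_dsum Y i)).
- move=> X Y a f g; apply: chmap_ext => i /=.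
  apply: (dsum_extr (D := compression_dsum X i)) => t.
  rewrite compDl compZl !(diagm_inj (compression_dsum X i)).
  exact: comp_linr.
Defined.

End Compression.

(* Main.v *)
Require Import Defs.
From HB Require Import structures.
From mathcomp Require Import all_boot all_order all_algebra.
From mathcomp Require Import boolp zify.
Import Defs.

(** An indecomposable periodic complex [Z] is found inside its own unrolling.

    Unroll [Z] to an unbounded complex, choose a degree [d] with [Z^d] nonzero and
    truncate to the degrees [l] with [|l - d| <= n].  The truncation is bounded,
    so some indecomposable summand [S] of it is nonzero in degree [d].  Being a
    shift of a complex concentrated in [1, n], it vanishes at both ends of the
    window, and therefore it is a summand of the whole unrolled complex
    ([truncation_ex]).  The unrolled complex does not change under translation by
    multiples of [m], so [S] may be replaced by [X], the shift of a complex in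
    [1, n] by some [t < m] ([unrolled_retract_shift]).

    On bounded complexes the compression functor [F] is left and right adjoint to
    unrolling.  Hence the split inclusion of [X] yields maps [F X -> Z -> F X]
    ([unrolled_retract_compression]).  Their composite [c] need not be the
    identity, but it differs from it only by components of nonzero degree on the
    total object of [X], the direct sum of all [X^l].  These components are
    harmless: a composite of a map of degree [s <> 0] with one of degree [- s] is
    an endomorphism of [X] that is not invertible, because [X] is bounded, and
    hence nilpotent by Fitting's lemma ([graded_chain_nil]).  So Gaussian
    elimination applies to the finitely many homogeneous parts of a [y] with
    [c y = 0] and shows [y = 0] ([chain_cancel]).  Fitting's lemma for [F X] turns
    this injectivity of [c] into bijectivity; thus [F X] is a nonzero direct
    summand of [Z], and all of [Z] since [Z] is indecomposable
    ([unrolled_retract_isomorphic]).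

    Two facts about the base category feed this argument.  Finite length of the
    morphism modules makes every endomorphism strongly pi-regular, and the
    resulting Fitting idempotents commute with differentials
    ([fitting_idempotent]).  The Krull-Schmidt property makes idempotents split
    ([krull_schmidt_splits]), first in the base category and then degreewise in
    complexes, so that indecomposability can be tested on idempotents.  Finally,
    every complex with finite support is a finite direct sum of indecomposables
    ([decomposition_ind]), and compression preserves direct sums; this gives
    density. *)

Set Implicit Arguments.
Unset Strict Implicit.
Unset Printing Implicit Defensive.
Import Order.TTheory GRing.Theory Num.Theory.
Local Open Scope ring_scope.
Local Open Scope kcat_scope.

(** * Modules of finite length *)

Section Length.
Variables (k : comPzRingType) (V : lmodType k).
Implicit Types N : V -> Prop.

Definition submodule N := N 0 /\ forall a x y, N x -> N y -> N (a *: x + y).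

Lemma submoduleB N x y : submodule N -> N x -> N y -> N (x - y).
Proof. by move=> [_ lN] Nx Ny; rewrite addrC -scaleN1r; exact: lN. Qed.

(** Intersecting with a composition series [M] and counting the indices at which
    something new appears is strictly increasing: an element of the larger
    submodule is pushed down the series, step by step, by subtracting elements
    of the smaller one, because each subquotient of [M] is simple. *)
Lemma finite_length_function : finite_length V ->
  exists len : (V -> Prop) -> nat,
    (forall N N', (forall x, N x -> N' x) -> (len N <= len N')%N) /\
    (forall N N', submodule N -> submodule N' -> (forall x, N x -> N' x) ->
       (len N' <= len N)%N -> forall x, N' x -> N x).
Proof.
move=> [n [M [subM M0 Mn simpleM]]].
pose jumps N := [set i : 'I_n |
  `[< exists x, [/\ N x, x \in M i.+1 & x \notin M i] >]]%SET.
have jumpsS N N' : (forall x, N x -> N' x) -> jumps N \subset jumps N'.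
  move=> NN'; apply/subsetP => i; rewrite !inE => /asboolP [x [Nx xi1 xi]].
  by apply/asboolP; exists x; split => //; exact: NN'.
exists (fun N => #|jumps N|); split.
  by move=> N N' NN'; apply: subset_leq_card; exact: jumpsS.
move=> N N' sN sN' NN' le_len.
have eq_jumps : jumps N = jumps N'.
  by apply/eqP; rewrite eqEcard jumpsS.
suff H i : (i <= n)%N -> forall x, N' x -> x \in M i -> N x.
  by move=> x N'x; apply: (H n) => //; rewrite Mn.
elim: i => [|i IHi] lt_in x N'x xM.
  by move: xM; rewrite M0 inE => /eqP ->; case: sN.
have [xi|xi] := boolP (x \in M i); first by apply: IHi => //; exact: ltnW.
have : Ordinal lt_in \in jumps N.
  by rewrite eq_jumps inE; apply/asboolP; exists x.
rewrite inE => /asboolP /= [z [Nz zi1 zi]].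
have [subMi _ maxMi] := simpleM i lt_in.
pose Q : {pred V} := [pred u |
  `[< exists y v, [/\ N y, y \in M i.+1, v \in M i & u = y + v] >]].
have QP u : reflect (exists y v, [/\ N y, y \in M i.+1, v \in M i & u = y + v])
    (u \in Q) by rewrite inE; exact: asboolP.
have [M0i linMi] := subM i; have [M0i1 linMi1] := subM i.+1.
have [N0 linN] := sN.
have sQ : GRing.submod_closed Q.
  split; first by apply/QP; exists 0, 0; split; rewrite ?addr0.
  move=> a u u' /QP [y [v [Ny yi vi ->]]] /QP [y' [v' [Ny' yi' vi' ->]]].
  apply/QP; exists (a *: y + y'), (a *: v + v'); split.
  - exact: linN.
  - exact: linMi1.
  - exact: linMi.
  - by rewrite scalerDr addrACA.
have MQ : {subset M i <= Q}.
  by move=> v vi; apply/QP; exists 0, v; split; rewrite ?add0r.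
have QM : {subset Q <= M i.+1}.
  move=> u /QP [y [v [_ yi vi ->]]]; rewrite -[y]scale1r; apply: linMi1 => //.
  exact: subMi.
case: (maxMi Q sQ MQ QM) => eQ.
  case/negP: zi; rewrite -eQ; apply/QP; exists z, 0; split; rewrite ?addr0 //.
have : x \in Q by rewrite eQ.
move=> /QP [y [v [Ny _ vi e]]].
have Nv : N v.
  apply: IHi => //; first exact: ltnW.
  have -> : v = x - y by rewrite e addrC addKr.
  by apply: submoduleB => //; exact: NN'.
by rewrite e -[y]scale1r; exact: linN.
Qed.

Lemma finite_length_dcc (N : nat -> V -> Prop) : finite_length V ->
  (forall j, submodule (N j)) -> (forall j x, N j.+1 x -> N j x) ->
  exists j, forall x, N j x -> N j.+1 x.
Proof.
move=> /finite_length_function [len [len_homo len_strict]] sN decN.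
apply: contrapT => /forallNP nj.
have lt j : (len (N j.+1) < len (N j))%N.
  rewrite ltnNge; apply/negP => le; apply: (nj j) => x.
  by apply: (len_strict (N j.+1)) => // y; exact: decN.
have le j : (len (N j) + j <= len (N 0%N))%N.
  by elim: j => [|j IHj]; [rewrite addn0|have := lt j; lia].
by have := le (len (N 0%N)).+1; lia.
Qed.

End Length.

(** * Endomorphism rings *)

Section Endo.
Variables (k : comPzRingType) (C : kcat k).

(** The alias carries the ring structure given by composition, while [hom X X]
    itself keeps only its module structure. *)
Definition endo (X : C) : Type := hom X X.

Section Ring.
Variable X : C.

HB.instance Definition _ := GRing.Zmodule.copy (endo X) (hom X X).

Fact endo_mulDl : left_distributive (fun f g : endo X => f \oc g) +%R.
Proof. by move=> f g h; exact: compDl. Qed.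
Fact endo_mulDr : right_distributive (fun f g : endo X => f \oc g) +%R.
Proof. by move=> f g h; exact: compDr. Qed.
Fact endo_mulA : associative (fun f g : endo X => f \oc g).
Proof. by move=> f g h; exact: compA. Qed.

HB.instance Definition _ := GRing.Zmodule_isPzRing.Build (endo X)
  endo_mulA (@comp1m _ _ _ _) (@compm1 _ _ _ _) endo_mulDl endo_mulDr.

Lemma endoM (f g : endo X) : f * g = f \oc g. Proof. by []. Qed.

End Ring.

Lemma compNl (X Y Z : C) (g : hom Y Z) (f : hom X Y) : (- g) \oc f = - (g \oc f).
Proof. by rewrite -scaleN1r compZl scaleN1r. Qed.

Lemma compNr (X Y Z : C) (g : hom Y Z) (f : hom X Y) : g \oc (- f) = - (g \oc f).
Proof. by rewrite -scaleN1r compZr scaleN1r. Qed.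

Lemma compBl (X Y Z : C) (g g' : hom Y Z) (f : hom X Y) :
  (g - g') \oc f = g \oc f - g' \oc f.
Proof. by rewrite compDl compNl. Qed.

Lemma compBr (X Y Z : C) (g : hom Y Z) (f f' : hom X Y) :
  g \oc (f - f') = g \oc f - g \oc f'.
Proof. by rewrite compDr compNr. Qed.

Lemma is_zeroP (X : C) : is_zero X <-> idm X = 0.
Proof.
split=> [[zX _]|e]; first exact: zX.
by split=> Y f; [rewrite -(compm1 f) e compm0|rewrite -(comp1m f) e comp0m].
Qed.

Lemma is_zero_eql (X Y : C) (f g : hom X Y) : is_zero X -> f = g.
Proof. by move=> [zX _]; rewrite (zX _ f) (zX _ g). Qed.

Lemma is_zero_eqr (X Y : C) (f g : hom Y X) : is_zero X -> f = g.
Proof. by move=> [_ zX]; rewrite (zX _ f) (zX _ g). Qed.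

(** Strong pi-regularity: both chains [f^j End] and [End f^j] are stationary from
    the index [n] on. *)
Definition pi_regular (X : C) (f : endo X) n :=
  (exists a : endo X, f ^+ n = f ^+ n.+1 * a) /\
  (exists b : endo X, f ^+ n = b * f ^+ n.+1).

Lemma pi_regular_leq (X : C) (f : endo X) m n :
  (m <= n)%N -> pi_regular f m -> pi_regular f n.
Proof.
move=> /subnKC <-; elim: (n - m)%N => [|d IHd] reg; first by rewrite addn0.
have [[a ea] [b eb]] := IHd reg; rewrite addnS; split.
  by exists a; rewrite exprS [in LHS]ea mulrA -exprS.
by exists b; rewrite exprSr [in LHS]eb -mulrA -exprSr.
Qed.

Lemma pi_regular_double (X : C) (f : endo X) n : pi_regular f n ->
  exists a b : endo X, f ^+ n = f ^+ n * f ^+ n * a /\ f ^+ n = b * (f ^+ n * f ^+ n).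
Proof.
move=> [[a ea] [b eb]].
have Ha j : f ^+ n = f ^+ j * f ^+ n * a ^+ j.
  elim: j => [|j IHj]; first by rewrite mul1r mulr1.
  rewrite {1}IHj {1}ea exprS [f ^+ j.+1]exprSr [a ^+ j.+1]exprS !mulrA.
  by rewrite -[f ^+ j * f * f ^+ n]mulrA.
have Hb j : f ^+ n = b ^+ j * (f ^+ n * f ^+ j).
  elim: j => [|j IHj]; first by rewrite mul1r mulr1.
  rewrite {1}IHj {1}eb exprSr [f ^+ j.+1]exprS [b ^+ j.+1]exprSr !mulrA.
  by rewrite -!mulrA.
by exists (a ^+ n), (b ^+ n).
Qed.

Lemma endo_pi_regular (X : C) (f : endo X) :
  finite_length (hom X X) -> exists n, pi_regular f n.
Proof.
move=> flX.
have [||n hn] := @finite_length_dcc _ _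
    (fun j (x : hom X X) => exists a : endo X, x = f ^+ j * a) flX.
- move=> j; split; first by exists 0; rewrite mulr0.
  move=> c x y [a ->] [a' ->]; exists (c *: (a : hom X X) + a').
  exact/esym/comp_linr.
- by move=> j x [a ->]; exists (f * a); rewrite exprSr mulrA.
have [||m hm] := @finite_length_dcc _ _
    (fun j (x : hom X X) => exists a : endo X, x = a * f ^+ j) flX.
- move=> j; split; first by exists 0; rewrite mul0r.
  move=> c x y [a ->] [a' ->]; exists (c *: (a : hom X X) + a').
  exact/esym/comp_linl.
- by move=> j x [a ->]; exists (a * f); rewrite exprS mulrA.
exists (maxn n m); split.
  have [|a e] := hn (f ^+ n); first by exists 1; rewrite mulr1.
  exists a; rewrite -[in LHS](subnK (leq_maxl n m)) exprD e mulrA -exprD.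
  by rewrite addnS subnK ?leq_maxl.
have [|a e] := hm (f ^+ m); first by exists 1; rewrite mul1r.
exists a; rewrite -[in LHS](subnKC (leq_maxr n m)) exprD e -mulrA -exprD.
by rewrite addSn subnKC ?leq_maxr.
Qed.

End Endo.

(** * Idempotents *)

Section Idempotents.
Variables (k : comPzRingType) (C : kcat k).

Lemma sum_inj_prj_fin (I : finType) (F : I -> C) X (D : dsum F X) :
  \sum_i inj D i \oc prj D i = idm X.
Proof.
rewrite -(sum_inj_prj D) (@fsum_seq _ _ (index_enum I)) ?index_enum_uniq //.
by move=> i; rewrite mem_index_enum.
Qed.

Definition dsum_of_fin (I : finType) (F : I -> C) X
  (i : forall x, hom (F x) X) (p : forall x, hom X (F x))
  (pi1 : forall x, p x \oc i x = idm (F x))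
  (pi0 : forall x y, x != y -> p y \oc i x = 0)
  (ip : \sum_x i x \oc p x = idm X) : dsum F X.
Proof.
apply: (DSum pi1 pi0); rewrite -ip (@fsum_seq _ _ (index_enum I)) ?index_enum_uniq //.
by move=> x; rewrite mem_index_enum.
Defined.

(** For nonzero objects whose idempotents split this is indecomposability.  Unlike
    the latter it is stated inside one endomorphism ring, so that it does not
    depend on the ambient full subcategory and passes to shifted complexes. *)
Definition idempotents_trivial (X : C) :=
  forall e : endo X, e * e = e -> e = 0 \/ e = 1.

Definition splits (X : C) (e : endo X) :=
  exists (W : C) (i : hom W X) (p : hom X W), p \oc i = idm W /\ i \oc p = e.

Definition biproduct (X W1 W2 : C) (i1 : hom W1 X) (p1 : hom X W1)
    (i2 : hom W2 X) (p2 : hom X W2) :=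
  [/\ p1 \oc i1 = idm W1, p2 \oc i2 = idm W2 & i1 \oc p1 + i2 \oc p2 = idm X].

Lemma biproduct_sym (X W1 W2 : C) (i1 : hom W1 X) (p1 : hom X W1)
    (i2 : hom W2 X) (p2 : hom X W2) :
  biproduct i1 p1 i2 p2 -> biproduct i2 p2 i1 p1.
Proof. by move=> [e1 e2 e]; split => //; rewrite addrC. Qed.

(** Composing the decomposition of the identity with [i1] leaves
    [i2 \oc p2 \oc i1 = 0], and [i2] is split. *)
Lemma biproduct0 (X W1 W2 : C) (i1 : hom W1 X) (p1 : hom X W1)
    (i2 : hom W2 X) (p2 : hom X W2) :
  biproduct i1 p1 i2 p2 -> p2 \oc i1 = 0.
Proof.
move=> [e1 e2 e].
have /eqP := comp1m i1.
rewrite -e compDl -(compA i1) e1 compm1 -[X in _ == X]addr0.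
rewrite (inj_eq (addrI _)) => /eqP e0.
by rewrite -(comp1m (p2 \oc i1)) -e2 -compA (compA i2) e0 compm0.
Qed.

Lemma biproduct_dsum (X W1 W2 : C) (i1 : hom W1 X) (p1 : hom X W1)
    (i2 : hom W2 X) (p2 : hom X W2) :
  biproduct i1 p1 i2 p2 -> dsum (fun b : bool => if b then W1 else W2) X.
Proof.
move=> bp; have [e1 e2 e] := bp.
apply: (@dsum_of_fin _ (fun b : bool => if b then W1 else W2) _
  (fun b => if b return hom (if b then W1 else W2) X then i1 else i2)
  (fun b => if b return hom X (if b then W1 else W2) then p1 else p2)).
- by case.
- by move=> [] [] // _; [exact: biproduct0 bp|exact: biproduct0 (biproduct_sym bp)].
- by rewrite big_bool.
Qed.

Lemma dsum_biproduct (F : bool -> C) X (D : dsum F X) :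
  biproduct (inj D true) (prj D true) (inj D false) (prj D false).
Proof. by split; rewrite ?prj_inj // -(sum_inj_prj_fin D) big_bool. Qed.

Lemma biproduct_exists (W1 W2 : C) : is_additive C ->
  exists X (i1 : hom W1 X) (p1 : hom X W1) (i2 : hom W2 X) (p2 : hom X W2),
    biproduct i1 p1 i2 p2.
Proof.
move=> /(_ bool (fun b => if b then W1 else W2)) [X [D]].
exists X, (inj D true : hom W1 X), (prj D true : hom X W1),
  (inj D false : hom W2 X), (prj D false : hom X W2).
exact: dsum_biproduct D.
Qed.

Lemma zero_exists : is_additive C -> exists O : C, is_zero O.
Proof.
move=> /(_ void (fun v => match v with end)) [O [D]].
exists O; apply/is_zeroP; rewrite -(sum_inj_prj_fin D) big_pred0 //.
Qed.

Lemma retract0 (X W : C) (i : hom W X) (p : hom X W) :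
  p \oc i = idm W -> i \oc p = 0 -> idm W = 0.
Proof.
move=> pi1 ip0; rewrite -(comp1m (idm W)) -pi1 -compA (compA i) ip0.
by rewrite comp0m compm0.
Qed.

Lemma splits_biproduct (X : C) (e : endo X) : e * e = e ->
  splits e -> splits (1 - e) ->
  exists W1 W2 (i1 : hom W1 X) (p1 : hom X W1) (i2 : hom W2 X) (p2 : hom X W2),
    [/\ biproduct i1 p1 i2 p2, i1 \oc p1 = e & i2 \oc p2 = 1 - e].
Proof.
move=> ee [W1 [i1 [p1 [e1 ie1]]]] [W2 [i2 [p2 [e2 ie2]]]].
exists W1, W2, i1, p1, i2, p2; split => //; split => //.
by rewrite ie1 ie2; exact: subrKC.
Qed.

Lemma splitsD (X : C) (e f : endo X) : is_additive C ->
  e * f = 0 -> f * e = 0 -> splits e -> splits f -> splits (e + f).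
Proof.
move=> addC ef fe [W1 [i1 [p1 [e1 ie1]]]] [W2 [i2 [p2 [e2 ie2]]]].
have [W [j1 [q1 [j2 [q2 bp]]]]] := biproduct_exists W1 W2 addC.
have q2j1 := biproduct0 bp; have q1j2 := biproduct0 (biproduct_sym bp).
have [E1 E2 E] := bp.
have p1i2 : p1 \oc i2 = 0.
  rewrite -(comp1m (p1 \oc i2)) -e1 -(compm1 (_ \oc _ \oc _)) -e2.
  rewrite -!compA (compA i1) ie1 (compA i2) ie2 (compA e).
  by rewrite (_ : e \oc f = 0) ?comp0m ?compm0.
have p2i1 : p2 \oc i1 = 0.
  rewrite -(comp1m (p2 \oc i1)) -e2 -(compm1 (_ \oc _ \oc _)) -e1.
  rewrite -!compA (compA i1) ie1 (compA i2) ie2 (compA f).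
  by rewrite (_ : f \oc e = 0) ?comp0m ?compm0.
exists W, (i1 \oc q1 + i2 \oc q2), (j1 \oc p1 + j2 \oc p2); split.
  rewrite !compDl !compDr !compA -!(compA _ p1) -!(compA _ p2) e1 e2 p1i2 p2i1.
  by rewrite !compm0 !comp0m !compm1 addr0 add0r.
rewrite !compDl !compDr !compA -!(compA _ q1) -!(compA _ q2) E1 E2 q1j2 q2j1.
by rewrite !compm0 !comp0m !compm1 addr0 add0r ie1 ie2.
Qed.

Lemma indecomposable_idempotents_trivial (X : C) :
  (forall e : endo X, e * e = e -> splits e) ->
  indecomposable X -> idempotents_trivial X.
Proof.
move=> spl [_ indX] e ee.
have ee' : (1 - e) * (1 - e) = 1 - e.
  by rewrite mulrBl mul1r mulrBr mulr1 ee subrr subr0.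
have [W1 [W2 [i1 [p1 [i2 [p2 [bp E1 E2]]]]]]] :=
  splits_biproduct ee (spl _ ee) (spl _ ee').
case: (indX _ (biproduct_dsum bp)) => /= [[z _]|[z _]].
  by left; rewrite -E1 (z _ i1) comp0m.
by right; apply/esym/eqP; rewrite -subr_eq0 -E2 (z _ i2) comp0m.
Qed.

Lemma idempotents_trivial_indecomposable (X : C) :
  ~ is_zero X -> idempotents_trivial X -> indecomposable X.
Proof.
move=> nz triv; split => // F D.
have bp := dsum_biproduct D; have [e1 e2 e] := bp.
have p2i1 := biproduct0 bp.
set i1 := inj D true in bp e1 e p2i1 *; set p1 := prj D true in bp e1 e p2i1 *.
have ee : (i1 \oc p1 : endo X) * (i1 \oc p1) = i1 \oc p1.
  by rewrite endoM compA -(compA i1) e1 compm1.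
case: (triv _ ee) => E; [left|right]; apply/is_zeroP.
  exact: retract0 e1 E.
apply: retract0 e2 _; rewrite -[LHS](addKr (i1 \oc p1)) e E.
exact: (addNr (1 : endo X)).
Qed.

End Idempotents.

Section Splitting.
Variables (k : comPzRingType) (C : kcat k).

Definition fixed_by (X : C) (e : endo X) (f : hom X X) := e \oc f = f.

Lemma fixed_by_submodule (X : C) (e : endo X) : submodule (fixed_by e).
Proof.
split=> [|a x y]; first exact: compm0.
by rewrite /fixed_by comp_linr => -> ->.
Qed.

Lemma fixed_byS (X : C) (e f : endo X) : f * e = e ->
  forall x, fixed_by e x -> fixed_by f x.
Proof. by move=> fe x <-; rewrite /fixed_by compA; congr (_ \oc _). Qed.

(** Otherwise [e] would lie in the radical.  Subtracting the terms [e J_i e] from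
    [e] one after the other, with [J_i] the idempotent of the [i]-th summand,
    preserves right invertibility relative to [e]: by the Woodbury formula this
    needs an inverse of [1 - x] for a non-isomorphism [x] of a local object.  In
    the end nothing is left of [e], since the [J_i] add up to the identity. *)
Lemma nonzero_idempotent_iso (X : C) (n : nat) (F : 'I_n -> C) (e : endo X) :
  dsum F X -> (forall i, local_end (F i)) -> e * e = e -> e <> 0 ->
  exists i (a : hom (F i) X) (b : hom X (F i)), is_iso (b \oc e \oc a).
Proof.
move=> D locF ee; apply: contra_notP => noiso.
have {}noiso i (a : hom (F i) X) (b : hom X (F i)) : ~ is_iso (b \oc e \oc a).
  by move=> h; apply: noiso; exists i, a, b.
pose J i : endo X := inj D i \oc prj D i.
have key (s : seq 'I_n) : exists y : endo X,
    (e - \sum_(i <- s) e * J i * e) * y = e /\ e * y = y.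
  elim: s => [|i s [y [zy ey]]].
    by exists e; rewrite big_nil subr0.
  rewrite big_cons opprD addrCA addrC.
  have : (e - \sum_(j <- s) e * J j * e) * e = e - \sum_(j <- s) e * J j * e.
    rewrite mulrBl ee mulr_suml; congr (_ - _); apply: eq_bigr => j _.
    by rewrite -[LHS]mulrA ee.
  move: (e - _) zy => z zy ze.
  pose x := prj D i \oc y \oc inj D i.
  have nx : ~ is_iso x.
    by rewrite /x -ey endoM (compA (prj D i)) -(compA _ y); exact: noiso.
  have [w [_ xw]] : is_iso (idm (F i) - x).
    apply: contrapT => nx'; apply: (proj2 (locF i) _ _ nx nx').
    by rewrite addrC subrK; exists (idm _); rewrite comp1m.
  (* The correction term of the Woodbury formula. *)
  pose Iw : endo X := inj D i \oc w \oc prj D i.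
  have JyI : J i * y * Iw = Iw - J i.
    have -> : J i * y * Iw = inj D i \oc (x \oc w) \oc prj D i.
      by rewrite !endoM /J /Iw /x !compA.
    have -> : x \oc w = w - idm (F i).
      by rewrite -xw compBl comp1m opprB addrC subrK.
    by rewrite compBr compBl compm1.
  have ey' : e * (y + y * Iw * y) = y + y * Iw * y by rewrite mulrDr !mulrA ey.
  exists (y + y * Iw * y); split => //.
  have Jy' : J i * (y + y * Iw * y) = Iw * y.
    by rewrite mulrDr !mulrA JyI mulrBl addrC subrK.
  rewrite mulrBl -(mulrA _ e) ey' -(mulrA e) Jy' mulrDr !mulrA zy.
  by rewrite addrK.
have [y []] := key (enum 'I_n).
rewrite -mulr_suml -mulr_sumr big_enum /=.
have -> : \sum_i J i = 1 by exact: sum_inj_prj_fin D.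
by rewrite mulr1 ee subrr mul0r.
Qed.

(** If [b e a] is invertible, then [e a] is a split monomorphism and its image is
    the image of a split idempotent [g] with [e g = g = g e].  Subtracting [g]
    from [e] decreases the length of the submodule of all [f] with [e f = f], so
    that the process ends. *)
Lemma krull_schmidt_splits (X : C) (e : endo X) :
  is_additive C -> krull_schmidt C -> finite_length (hom X X) ->
  e * e = e -> splits e.
Proof.
move=> addC ksC flX; have [n [F [[D] locF]]] := ksC X.
have [len [len_homo len_strict]] := finite_length_function flX.
have [N] := ubnP (len (fixed_by e)); elim: N e => // N IHN e le_eN ee.
have [e0|/eqP ne0] := eqVneq e 0.
  have [O /is_zeroP O0] := zero_exists addC.
  exists O, 0, 0; split; first by rewrite O0 comp0m.
  by rewrite e0 comp0m.
have [i [a [b [v [vl vr]]]]] := nonzero_idempotent_iso D locF ee ne0.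
pose j : hom (F i) X := e \oc a; pose q : hom X (F i) := v \oc b \oc e.
have ee' : e \oc e = e := ee.
have qj : q \oc j = idm (F i).
  by rewrite -vl /q /j -!compA (compA e) ee'.
pose g : endo X := j \oc q.
have eg : e * g = g by rewrite endoM /g /j !compA ee'.
have ge : g * e = g by rewrite endoM /g /q -!compA ee'.
have gg : g * g = g by rewrite endoM /g compA -(compA j) qj compm1.
have hh : (e - g) * (e - g) = e - g.
  by rewrite mulrBl !mulrBr ee eg ge gg subrr subr0.
rewrite -(subrK g e); apply: splitsD => //.
- by rewrite mulrBl eg gg subrr.
- by rewrite mulrBr ge gg subrr.
- apply: IHN => //; move: le_eN; rewrite ltnS; apply: leq_trans.
  rewrite ltnNge; apply/negP => le.
  have he : e * (e - g) = e - g by rewrite mulrBr ee eg.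
  have /= := len_strict _ _ (fixed_by_submodule _) (fixed_by_submodule _)
    (fixed_byS he) le e ee.
  rewrite /fixed_by -endoM mulrBl ee ge => /eqP.
  rewrite subr_eq -subr_eq0 opprD addrA subrr sub0r oppr_eq0 => /eqP g0.
  by case: (locF i) => + _; apply; exact: retract0 qj g0.
- by exists (F i), j, q.
Qed.

End Splitting.

(** * Complexes with finite support *)

Section Complexes.
Variables (k : comPzRingType) (A : kcat k) (I : eqType) (r : rel I).
Local Notation C := (complexes A r).
Implicit Types X Y : C.

Definition degree X (f : endo X) i : endo ((X : complex A r) i) :=
  chm (f : chmap X X) i.

Lemma degreeM X (f g : endo X) i : degree (f * g) i = degree f i * degree g i.
Proof. by []. Qed.

Lemma degreeX X (f : endo X) n i : degree (f ^+ n) i = degree f i ^+ n.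
Proof. by elim: n => [|n IHn]; rewrite ?expr0 // !exprS degreeM IHn. Qed.

Lemma degree_inj X (f g : endo X) : (forall i, degree f i = degree g i) -> f = g.
Proof. exact: chmap_ext. Qed.

Lemma complex_is_zero X : is_zero X <-> forall i, is_zero ((X : complex A r) i).
Proof.
split=> [/is_zeroP X0 i|X0]; apply/is_zeroP.
  exact: (congr1 (fun f : chmap X X => f i) X0).
by apply: chmap_ext => i; apply/is_zeroP.
Qed.

Lemma chmap_is_iso X Y (f : chmap X Y) :
  (forall i, is_iso (f i)) -> is_iso (f : @hom k C X Y).
Proof.
move=> isof; pose g i : hom (Y i) (X i) := projT1 (cid (isof i)).
have gf i : g i \oc f i = idm (X i) by rewrite /g; case: cid => ? [].
have fg i : f i \oc g i = idm (Y i) by rewrite /g; case: cid => ? [].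
have gP i j : diff X i j \oc g i = g j \oc diff Y i j.
  rewrite -[LHS]comp1m -gf -compA (compA (f j)) -(chmP f) -!compA fg.
  by rewrite compm1.
by exists (ChMap g gP); split; apply: chmap_ext.
Qed.

Lemma complex_splits X (e : endo X) :
  (forall i, splits (degree e i)) -> splits e.
Proof.
move=> spl.
pose W i := projT1 (cid (spl i)); have PW i := projT2 (cid (spl i)).
pose s i : hom (W i) (X i) := projT1 (cid (PW i)); have Ps i := projT2 (cid (PW i)).
pose p i : hom (X i) (W i) := projT1 (cid (Ps i)).
have Pp i : p i \oc s i = idm (W i) /\ s i \oc p i = degree e i :=
  projT2 (cid (Ps i)).
have ps i := proj1 (Pp i).
have sp i : s i \oc p i = chm (e : chmap X X) i := proj2 (Pp i).
have pe i : p i \oc chm (e : chmap X X) i = p i by rewrite -sp compA ps comp1m.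
have es i : chm (e : chmap X X) i \oc s i = s i by rewrite -sp -compA ps compm1.
have Wsh i j : ~~ r i j -> p j \oc diff X i j \oc s i = 0.
  by move=> rij; rewrite (diff_shape _ rij) compm0 comp0m.
have Wdd i j l : p l \oc diff X j l \oc s j \oc (p j \oc diff X i j \oc s i) = 0.
  rewrite !compA -(compA _ (s j)) sp -(compA _ (diff X j l)) chmP.
  by rewrite (compA (p l)) pe -(compA (p l)) diff_diff compm0 comp0m.
pose V : C := Complex W (fun i j => p j \oc diff X i j \oc s i) Wsh Wdd.
have sP i j : diff X i j \oc s i = s j \oc (p j \oc diff X i j \oc s i).
  by rewrite !compA sp -chmP -compA es.
have pP i j : p j \oc diff X i j \oc s i \oc p i = p j \oc diff X i j.
  by rewrite -compA sp -compA chmP compA pe.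
exists V, (ChMap (X := V) s sP), (ChMap (Y := V) p pP).
by split; apply: chmap_ext.
Qed.

Definition finitely_supported X :=
  exists s : seq I, forall i, i \notin s -> is_zero ((X : complex A r) i).

(** Fitting's lemma without splitting: the idempotents that the strongly
    pi-regular endomorphisms [f^i] define degree by degree commute with the
    differential, because [(1 - e) d f^n = 0] and [f^n d (1 - e) = 0]. *)
Lemma fitting_idempotent X (f : endo X) : hom_finite A -> finitely_supported X ->
  exists n (e : endo X), [/\ e * e = e, f ^+ n * e = f ^+ n & e = 1 -> is_iso f].
Proof.
move=> flA [s Xs].
have [n reg] : exists n, forall i, pi_regular (degree f i) n.
  have [n reg] : exists n, forall i, i \in s -> pi_regular (degree f i) n.
    elim: s {Xs} => [|i s [n IHs]]; first by exists 0%N.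
    have [m fm] := endo_pi_regular (degree f i) (flA _ _).
    exists (maxn m n) => j; rewrite inE => /predU1P [->|js].
      exact: pi_regular_leq (leq_maxl _ _) fm.
    exact: pi_regular_leq (leq_maxr _ _) (IHs j js).
  exists n => i; have [/reg //|/Xs zi] := boolP (i \in s).
  by split; exists 0; exact: is_zero_eql zi.
(* A positive exponent is needed to read off an inverse of [f] when [e = 1]. *)
have {}reg i := pi_regular_double (pi_regular_leq (leqnSn n) (reg i)).
set N := n.+1 in reg.
pose a i := projT1 (cid (reg i)); have Pa i := projT2 (cid (reg i)).
pose b i := projT1 (cid (Pa i)).
have fa i : degree f i ^+ N = degree f i ^+ N * degree f i ^+ N * a i.
  by have [] := projT2 (cid (Pa i)).
have fb i : degree f i ^+ N = b i * (degree f i ^+ N * degree f i ^+ N).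
  by have [] := projT2 (cid (Pa i)).
pose e i := degree f i ^+ N * a i.
have eE i : e i = b i * degree f i ^+ N by rewrite /e {1}fb -mulrA -fa.
have ef i : e i * degree f i ^+ N = degree f i ^+ N by rewrite eE -mulrA -fb.
have fe i : degree f i ^+ N * e i = degree f i ^+ N by rewrite /e mulrA -fa.
have ee i : e i * e i = e i by rewrite {2}/e mulrA ef.
have dfN i j : diff X i j \oc degree f i ^+ N = degree f j ^+ N \oc diff X i j.
  by rewrite -!degreeX; exact: chmP.
have eP i j : diff X i j \oc e i = e j \oc diff X i j.
  have de : diff X i j \oc e i = (degree f j ^+ N : hom _ _) \oc (diff X i j \oc a i).
    by rewrite /e endoM compA dfN -compA.
  have ed : e j \oc diff X i j = b j \oc diff X i j \oc degree f i ^+ N.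
    by rewrite eE endoM -compA -dfN compA.
  transitivity (e j \oc (diff X i j \oc e i)).
    by rewrite de [in RHS]compA; congr (_ \oc _); exact/esym/ef.
  by rewrite compA ed -compA; congr (_ \oc _); exact: fe.
exists N, (ChMap e eP : endo X); split.
- by apply: degree_inj => i; exact: ee.
- by apply: degree_inj => i; rewrite degreeM degreeX; exact: fe.
- move=> e1; apply: chmap_is_iso => i.
  have ei1 : e i = 1 by have := congr1 (fun x => degree x i) e1.
  have l : b i * degree f i ^+ n * degree f i = 1 by rewrite -mulrA -exprSr -eE.
  have r' : degree f i * (degree f i ^+ n * a i) = 1 by rewrite mulrA -exprS.
  exists (b i * degree f i ^+ n); split; first exact: l.
  have -> : b i * degree f i ^+ n = degree f i ^+ n * a i; last exact: r'.
  by rewrite -[LHS]mulr1 -r' mulrA l mul1r.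
Qed.

(** Splitting off a nontrivial idempotent decreases the length, summed over the
    degrees, of the submodule of endomorphisms fixed by an idempotent; so the
    process ends with complexes that have only trivial idempotents. *)
Lemma decomposition_ind (Q : C -> Prop) :
  (forall X, forall e : endo X, e * e = e -> splits e) -> hom_finite A ->
  (forall X, is_zero X -> Q X) ->
  (forall X, ~ is_zero X -> idempotents_trivial X -> Q X) ->
  (forall X W1 W2 (i1 : hom W1 X) (p1 : hom X W1) (i2 : hom W2 X) (p2 : hom X W2),
     biproduct i1 p1 i2 p2 -> Q W1 -> Q W2 -> Q X) ->
  forall X, finitely_supported X -> Q X.
Proof.
move=> spl flA Q0 Q1 Q2 X [s Xs].
have len_ex i := finite_length_function (flA (X i) (X i)).
pose len i := projT1 (cid (len_ex i)).
have lenP i : _ := projT2 (cid (len_ex i)).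
pose size (e : endo X) := \sum_(i <- s) len i (fixed_by (degree e i)).
have size_homo (e f : endo X) : f * e = e -> (size e <= size f)%N.
  move=> fe; apply: leq_sum => i _; apply: (proj1 (lenP i)).
  by apply: fixed_byS; rewrite -degreeM fe.
have size_strict (e f : endo X) :
    f * e = e -> f * f = f -> (size f <= size e)%N -> e * f = f.
  move=> fe ff le; apply: degree_inj => i.
  have fei : degree f i * degree e i = degree e i by rewrite -degreeM fe.
  have [si|/Xs zi] := boolP (i \in s); last exact: is_zero_eql zi.
  have ffi : degree f i * degree f i = degree f i by rewrite -degreeM ff.
  apply: (proj2 (lenP i) _ _ (fixed_by_submodule _) (fixed_by_submodule _)
    (fixed_byS fei) _ _ ffi).
  have le_i j : (len j (fixed_by (degree e j)) <= len j (fixed_by (degree f j)))%N.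
    by apply: (proj1 (lenP j)); apply: fixed_byS; rewrite -degreeM fe.
  rewrite leqNgt; apply/negP => lt; move: le; rewrite leqNgt => /negP; apply.
  rewrite /size (perm_big _ (perm_to_rem si)) /= big_cons.
  rewrite [in ltnRHS](perm_big _ (perm_to_rem si)) /= big_cons.
  by rewrite -addSn leq_add // leq_sum.
suff H N W (i : hom W X) (p : hom X W) : p \oc i = idm W ->
    (size (i \oc p) < N)%N -> Q W.
  by apply: (H (size 1).+1 X (idm X) (idm X)); rewrite ?comp1m.
elim: N W i p => // N IHN W i p pi1 ltN.
have [/Q0 //|nzW] := pselect (is_zero W).
have [/(Q1 _ nzW) //|] := pselect (idempotents_trivial W).
move=> /existsNP [e /not_implyP [ee /not_orP [ne0 ne1]]].
have ee' : (1 - e) * (1 - e) = 1 - e.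
  by rewrite mulrBl mul1r mulrBr mulr1 ee subrr subr0.
have [W1 [W2 [i1 [p1 [i2 [p2 [bp E1 E2]]]]]]] :=
  splits_biproduct ee (spl _ _ ee) (spl _ _ ee').
have sub V1 V2 (j1 : hom V1 W) (q1 : hom W V1) (j2 : hom V2 W) (q2 : hom W V2) :
    biproduct j1 q1 j2 q2 -> j2 \oc q2 <> 0 -> Q V1.
  move=> bp' ne; have [q1j1 q2j2 _] := bp'.
  apply: (IHN V1 (i \oc j1) (q1 \oc p)).
    by rewrite !compA -(compA q1) pi1 compm1.
  move: ltN; rewrite ltnS; apply: leq_trans.
  rewrite ltnNge; apply/negP => le; apply: ne.
  have /(_ _ _ le) ef := @size_strict (i \oc j1 \oc (q1 \oc p)) (i \oc p).
  have {ef} : i \oc j1 \oc (q1 \oc p) \oc (i \oc p) = i \oc p.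
    apply: ef; rewrite !endoM !compA -(compA i) pi1 compm1 //.
  move=> /(congr1 (fun x => p \oc x \oc i)).
  rewrite !compA pi1 -!(compA _ p) pi1 !compm1 comp1m => j1q1.
  have [_ _ e1] := bp'; move: e1; rewrite j1q1 -[RHS]addr0.
  by move=> /addrI.
have ee1 : i1 \oc p1 <> 0 by rewrite E1.
have ee2 : i2 \oc p2 <> 0.
  by rewrite E2 => /eqP; rewrite subr_eq0 => /eqP e1; apply: ne1.
apply: (Q2 _ _ _ _ _ _ _ bp); first exact: sub bp ee2.
exact: sub (biproduct_sym bp) ee1.
Qed.

End Complexes.

(** * Cancellation in graded rings *)

Section GradedCancellation.
Variables (R : pzRingType) (H : int -> R -> Prop).
Hypothesis homogB : forall s x y, H s x -> H s y -> H s (x - y).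
Hypothesis homogM : forall s t x y, H s x -> H t y -> H (s + t) (x * y).
Hypothesis homog1 : H 0 1.
Hypothesis homog_nil : forall s a b,
  s != 0 -> H s a -> H (- s) b -> exists n, (b * a) ^+ n = 0.

Definition left_unit0 (x : R) := exists2 w, H 0 w & w * x = 1.

Lemma homogD s x y : H s x -> H s y -> H s (x + y).
Proof.
move=> Hx Hy; rewrite -[y]opprK; apply: homogB => //.
by rewrite -sub0r -(subrr y); do 2!apply: homogB => //.
Qed.

(** The geometric series of the nilpotent element [b * a]. *)
Lemma left_unit0_sub (s : int) (a b : R) :
  s != 0 -> H s a -> H (- s) b -> left_unit0 (1 - b * a).
Proof.
move=> s0 Ha Hb; have [n nil] := homog_nil s0 Ha Hb.
have Hx : H 0 (b * a) by rewrite -(addNr s); exact: homogM.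
suff [w [Hw e _]] : exists w, [/\ H 0 w, w * (1 - b * a) = 1 - (b * a) ^+ n
    & H 0 ((b * a) ^+ n)].
  by exists w; rewrite // e nil subr0.
move: (b * a) Hx {nil} => x Hx; elim: n => [|n [w [Hw e Hxn]]].
  exists 0; rewrite mul0r subrr; split => //.
  by rewrite -[X in H _ X](subrr 1); exact: homogB.
exists (w + x ^+ n); split; first exact: homogD.
  by rewrite mulrDl e mulrBr mulr1 -exprSr addrA subrK.
by rewrite exprS -(addr0 0); exact: homogM.
Qed.

(** Gaussian elimination.  The diagonal entries remain invertible: eliminating
    the index [q] changes the entry [M t t] by a product of elements of the
    opposite nonzero degrees [t - q] and [q - t]. *)
Lemma graded_elimination (s : seq int) (M : int -> int -> R) (v : int -> R) :
  uniq s -> {in s &, forall t u, H (t - u) (M t u)} ->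
  {in s, forall t, left_unit0 (M t t)} ->
  {in s, forall t, \sum_(u <- s) M t u * v u = 0} ->
  {in s, forall t, v t = 0}.
Proof.
elim: s M => // q s IHs M /= /andP [qs us] HM HMd eqs.
have [w Hw wM] := HMd q (mem_head _ _).
pose S := \sum_(u <- s) M q u * v u.
have vq : v q = - (w * S).
  have := eqs q (mem_head _ _); rewrite big_cons => /(congr1 ( *%R w)).
  rewrite mulrDr mulrA wM mul1r mulr0 => /eqP.
  by rewrite addr_eq0 => /eqP.
have vs : {in s, forall t, v t = 0}.
  apply: (IHs (fun t u => M t u - M t q * w * M q u)) => //.
  - move=> t u ts us'; apply: homogB; first by apply: HM; rewrite inE ?ts ?us' orbT.
    have -> : t - u = t - q + 0 + (q - u) by rewrite addr0 addrA subrK.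
    apply: homogM; [apply: homogM => //|]; apply: HM;
      by rewrite ?inE ?eqxx ?ts ?us' ?orbT.
  - move=> t ts; have tqs : t \in q :: s by rewrite inE ts orbT.
    have [wt Hwt wtM] := HMd t tqs.
    have tq : t - q != 0 by rewrite subr_eq0; apply: contraNneq qs => <-.
    have Ha : H (q - t) (M q t) by apply: HM => //; exact: mem_head.
    have Hb : H (- (q - t)) (wt * (M t q * w)).
      rewrite opprB -[t - q]add0r; apply: homogM => //.
      by rewrite -[t - q]addr0; apply: homogM => //; apply: HM => //; exact: mem_head.
    have [|w' Hw' e] := left_unit0_sub _ Ha Hb.
      by rewrite -opprB oppr_eq0.
    exists (w' * wt); first by rewrite -(addr0 0); exact: homogM.
    by rewrite -mulrA mulrBr wtM -[RHS]e !mulrA.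
  - move=> t ts; have tqs : t \in q :: s by rewrite inE ts orbT.
    rewrite -[RHS](eqs t tqs) big_cons vq mulrN !mulrA -mulNr mulr_sumr -big_split /=.
    by apply: eq_bigr => u _; rewrite mulrBl mulNr !mulrA addrC.
move=> t; rewrite inE => /predU1P [->|]; last exact: vs.
rewrite vq /S big_seq big1 ?mulr0 ?oppr0 // => u us'.
by rewrite vs // mulr0.
Qed.

End GradedCancellation.

(** * The total object of a bounded complex *)

Lemma bounded_finitely_supported (k : comPzRingType) (A : kcat k)
  (X : complexes A succz) : bounded X -> finitely_supported X.
Proof.
move=> [N XN]; exists [seq j%:Z - N%:Z | j <- iota 0 (N + N).+1] => i /negP Ni.
apply: XN; rewrite ltnNge; apply/negP => le; apply: Ni; apply/mapP.
by exists `|(i + N%:Z)%R|%N; [rewrite mem_iota|]; lia.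
Qed.

Section TotalObject.
Variables (k : comPzRingType) (A : kcat k) (X : complexes A succz).
Let Xc : complex A succz := X.
Variables (T : A) (D : dsum (fun l => Xc l) T) (d : endo T).
Hypothesis dE : forall l l', prj D l' \oc d \oc inj D l = diff Xc l l'.
Implicit Types (x y z : endo T) (l s t : int).

Definition entry y l l' : hom (Xc l) (Xc l') := prj D l' \oc y \oc inj D l.

Definition graded s y := forall l l', l' != l + s -> entry y l l' = 0.

Definition part s y : endo T :=
  mxm D D (fun l l' => if l' == l + s then entry y l l' else 0).

Lemma entry_ext x y : (forall l l', entry x l l' = entry y l l') -> x = y.
Proof.
move=> e; apply: (dsum_extr (D := D)) => l; apply: (dsum_extl (D := D)) => l'.
by rewrite !compA; exact: e.
Qed.

Lemma entryB x y l l' : entry (x - y) l l' = entry x l l' - entry y l l'.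
Proof. by rewrite /entry compBr compBl. Qed.

Lemma entry0 l l' : entry 0 l l' = 0.
Proof. by rewrite /entry compm0 comp0m. Qed.

Lemma entryD x y l l' : entry (x + y) l l' = entry x l l' + entry y l l'.
Proof. by rewrite /entry compDr compDl. Qed.

Lemma entry_sum (S : seq int) (F : int -> endo T) l l' :
  entry (\sum_(u <- S) F u) l l' = \sum_(u <- S) entry (F u) l l'.
Proof.
exact: (big_morph (fun y => entry y l l') (fun x y => entryD x y l l') (entry0 l l')).
Qed.

Lemma entry_part s y l l' :
  entry (part s y) l l' = if l' == l + s then entry y l l' else 0.
Proof. exact: mxmE. Qed.

Lemma gradedB s x y : graded s x -> graded s y -> graded s (x - y).
Proof. by move=> gx gy l l' ne; rewrite entryB gx // gy // subr0. Qed.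

Lemma graded1 : graded 0 1.
Proof.
move=> l l'; rewrite addr0 /entry compm1 eq_sym => ne.
exact: (prj_inj0 D).
Qed.

Lemma graded_inj s y l : graded s y ->
  y \oc inj D l = inj D (l + s) \oc entry y l (l + s).
Proof.
move=> gy; apply: (dsum_extl (D := D)) => l'.
case: (eqVneq l' (l + s)) => [->|ne]; first by rewrite !compA prj_inj comp1m.
by rewrite !compA (prj_inj0 D) 1?eq_sym // !comp0m; exact: (gy l l' ne).
Qed.

Lemma graded_prj s y l : graded s y ->
  prj D (l + s) \oc y = entry y l (l + s) \oc prj D l.
Proof.
move=> gy; apply: (dsum_extr (D := D)) => l'.
case: (eqVneq l' l) => [->|ne]; first by rewrite -[RHS]compA prj_inj compm1.
rewrite -[RHS]compA (prj_inj0 D) // compm0; apply: gy.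
by rewrite (inj_eq (addIr s)) eq_sym.
Qed.

Lemma entry_mulr s x z l l' : graded s z ->
  entry (x * z) l l' = entry x (l + s) l' \oc entry z l (l + s).
Proof. by move=> gz; rewrite {1}/entry endoM -!compA (graded_inj l gz) /entry !compA. Qed.

Lemma entry_mull s x z l l' : graded s z ->
  entry (z * x) l (l' + s) = entry z l' (l' + s) \oc entry x l l'.
Proof. by move=> gz; rewrite {1}/entry endoM compA (graded_prj l' gz) /entry -!compA. Qed.

Lemma gradedM s t x z : graded s x -> graded t z -> graded (s + t) (x * z).
Proof.
move=> gx gz l l' ne; rewrite (entry_mulr _ _ _ gz) gx ?comp0m //.
by rewrite -addrA (addrC t).
Qed.

Lemma part_graded s y : graded s (part s y).
Proof. by move=> l l' /negbTE ne; rewrite entry_part ne. Qed.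

Lemma part_sum s (S : seq int) (F : int -> endo T) :
  part s (\sum_(u <- S) F u) = \sum_(u <- S) part s (F u).
Proof.
apply: entry_ext => l l'; rewrite entry_sum entry_part entry_sum.
case: ifP => e; last by rewrite big1 // => u _; rewrite entry_part e.
by apply: eq_bigr => u _; rewrite entry_part e.
Qed.

Lemma part_mulr s t x z : graded t z -> part s (x * z) = part (s - t) x * z.
Proof.
move=> gz; apply: entry_ext => l l'.
rewrite (entry_mulr _ _ _ gz) !entry_part (entry_mulr _ _ _ gz).
have -> : l + t + (s - t) = l + s by lia.
by case: ifP; rewrite ?comp0m.
Qed.

Lemma part_mull s t x z : graded t z -> part s (z * x) = z * part (s - t) x.
Proof.
move=> gz; apply: entry_ext => l l'; rewrite -(subrK t l').
rewrite (entry_mull _ _ _ gz) !entry_part (entry_mull _ _ _ gz).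
have -> : (l' - t + t == l + s) = (l' - t == l + (s - t)) by lia.
by case: ifP; rewrite ?compm0.
Qed.

(** A finite direct sum suffices: all but finitely many [X^l] vanish, and the
    degrees that occur are the differences of the remaining indices. *)
Lemma sum_part : exists2 S : seq int, uniq S &
  forall y, y = \sum_(s <- S) part s y.
Proof.
have [S [uS i0 p0 _]] := dsum_fin D.
exists (undup [seq l' - l | l <- S, l' <- S]); first exact: undup_uniq.
move=> y; apply: entry_ext => l l'; rewrite entry_sum.
have [lS|lS] := boolP (l \in S); last first.
  by rewrite {1}/entry i0 // compm0 big1 // => u _; rewrite /entry i0 // compm0.
have [l'S|l'S] := boolP (l' \in S); last first.
  by rewrite {1}/entry p0 // !comp0m big1 // => u _; rewrite /entry p0 // !comp0m.
rewrite (bigD1_seq (l' - l)) ?undup_uniq //=; last first.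
  by rewrite mem_undup; apply/allpairsP; exists (l, l').
rewrite entry_part (addrC l) subrK eqxx big1 ?addr0 // => u ne.
rewrite entry_part; case: eqP => // e; case/eqP: ne; rewrite e; lia.
Qed.

Lemma graded_diff : graded 1 d.
Proof. by move=> l l' ne; rewrite /entry dE diff_shape. Qed.

Definition graded_chain s y := graded s y /\ y * d = d * y.

Lemma part_chain s y : y * d = d * y -> graded_chain s (part s y).
Proof.
move=> yd; split; first exact: part_graded.
have /= := part_mulr (s + 1) y graded_diff; rewrite addrK => <-.
by rewrite yd (part_mull _ _ graded_diff) addrK.
Qed.

Lemma graded0_inj y l : graded 0 y -> y \oc inj D l = inj D l \oc entry y l l.
Proof. by move=> gy; have := graded_inj l gy; rewrite addr0. Qed.

Lemma graded0_prj y l : graded 0 y -> prj D l \oc y = entry y l l \oc prj D l.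
Proof. by move=> gy; have := graded_prj l gy; rewrite addr0. Qed.

(** Elements of degree zero commuting with the differential are the
    endomorphisms of the complex. *)
Definition chain_of y (cy : graded_chain 0 y) : endo X.
Proof.
refine (ChMap (X := Xc) (Y := Xc) (fun l => entry y l l) _) => i j.
have [gy yd] := cy.
rewrite -dE -!compA -graded0_inj // !compA -graded0_prj //.
by congr (_ \oc _); rewrite -!(compA (prj D j)) -!endoM yd.
Defined.

Hypotheses (bX : bounded Xc) (nzX : ~ is_zero X) (trivX : idempotents_trivial X)
  (flA : hom_finite A).

(** The composite [b * a] is an endomorphism of [X] that factors through [X]
    translated by [s <> 0], so it is no isomorphism; by Fitting's lemma it is
    nilpotent. *)
Lemma graded_chain_nil s a b : s != 0 ->
  graded_chain s a -> graded_chain (- s) b -> exists n, (b * a) ^+ n = 0.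
Proof.
move=> s0 [ga ad] [gb bd].
have cba : graded_chain 0 (b * a).
  split; first by rewrite -(addNr s); exact: gradedM.
  by rewrite -mulrA ad mulrA bd mulrA.
have [gba _] := cba.
have [n [e [ee fe isof]]] :=
  fitting_idempotent (chain_of cba) flA (bounded_finitely_supported bX).
exists n; case: (trivX ee) => [e0|/isof [g [_ fg]]].
  have fn0 : chain_of cba ^+ n = 0 by rewrite -fe e0 mulr0.
  apply: (dsum_extr (D := D)) => l; rewrite comp0m.
  have -> : ((b * a) ^+ n : endo T) \oc inj D l =
      inj D l \oc (entry (b * a) l l : endo (Xc l)) ^+ n.
    elim: n {fe fn0} => [|n IHn]; first by rewrite compm1 comp1m.
    by rewrite !exprSr !endoM -compA graded0_inj // !compA IHn.
  by have := degreeX (chain_of cba) n l; rewrite fn0 => <-; rewrite compm0.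
(* An isomorphism forces the support of [X] to be stable under translation by
   [s], against boundedness. *)
have step l : is_zero (Xc (l + s)) -> is_zero (Xc l).
  move=> z; apply/is_zeroP; have := congr1 (fun f : chmap Xc Xc => f l) fg.
  rewrite /= (entry_mulr _ _ _ ga) => <-.
  by rewrite (is_zero_eqr (entry a l (l + s)) 0 z) compm0 comp0m.
case: nzX; apply/complex_is_zero => l.
have steps j : is_zero (Xc (l + s *+ j)) -> is_zero (Xc l).
  elim: j => [|j IHj]; first by rewrite addr0.
  by rewrite mulrSr addrA => /step.
have [N XN] := bX; apply: (steps (N + `|l|).+1); apply: XN; nia.
Qed.

(** In degree [t] the equation [c y = 0] reads [\sum_u c_(t - u) y_u = 0].  Only
    the finitely many degrees [u] of the parts of [y] enter, and the square
    system with rows [t] among these degrees has [c_0 = 1] on its diagonal, so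
    that elimination solves it. *)
Lemma chain_cancel c y : c * d = d * c -> y * d = d * y ->
  (forall l, entry c l l = idm (Xc l)) -> c * y = 0 -> y = 0.
Proof.
move=> cd yd c1 cy; have [S uS sumS] := sum_part.
have HB s u v : graded_chain s u -> graded_chain s v -> graded_chain s (u - v).
  move=> [gu ud] [gv vd]; split; first exact: gradedB.
  by rewrite mulrBl mulrBr ud vd.
have HM s t u v : graded_chain s u -> graded_chain t v -> graded_chain (s + t) (u * v).
  move=> [gu ud] [gv vd]; split; first exact: gradedM.
  by rewrite -mulrA vd mulrA ud mulrA.
have H1 : graded_chain 0 1 by split; [exact: graded1|rewrite mul1r mulr1].
have y0 : {in S, forall t, part t y = 0}.
  apply: (graded_elimination HB HM H1 graded_chain_nil
    (M := fun t u => part (t - u) c)) => //.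
  - by move=> t u _ _; exact: part_chain.
  - move=> t _; exists 1 => //; rewrite subrr mul1r; apply: entry_ext => l l'.
    rewrite entry_part addr0; case: eqP => [->|/eqP ne].
      by rewrite c1 /entry compm1 prj_inj.
    by rewrite graded1 // addr0.
  - move=> t _; transitivity (part t (c * y)); last first.
      by rewrite cy; apply: entry_ext => l l'; rewrite entry_part entry0 if_same.
    rewrite [in RHS](sumS y) mulr_sumr part_sum; apply: eq_bigr => u _.
    by rewrite (part_mulr _ _ (@part_graded u y)).
by rewrite (sumS y) big_seq big1.
Qed.

End TotalObject.

(** * Compression of a retract of the unrolled complex *)

Section Copair.
Variables (k : comPzRingType) (C : kcat k).

Definition dsum_unit (Y : C) : dsum (fun _ : unit => Y) Y.
Proof.
apply: (@dsum_of_fin _ C unit (fun _ => Y) Y (fun _ => idm Y) (fun _ => idm Y)).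
- by move=> _; rewrite comp1m.
- by case=> [] [].
- by rewrite (big_pred1 tt) ?comp1m //; case.
Defined.

Variables (I : choiceType) (F : I -> C) (X : C) (D : dsum F X).

Definition dsum_copair Y (f : forall i, hom (F i) Y) : hom X Y :=
  mxm D (dsum_unit Y) (fun i _ => f i).

Definition dsum_pair Y (f : forall i, hom Y (F i)) : hom Y X :=
  mxm (dsum_unit Y) D (fun _ i => f i).

Lemma dsum_copair_inj Y (f : forall i, hom (F i) Y) i : dsum_copair f \oc inj D i = f i.
Proof.
by have /= := mxmE D (dsum_unit Y) (fun i _ => f i) i tt; rewrite comp1m.
Qed.

Lemma prj_dsum_pair Y (f : forall i, hom Y (F i)) i : prj D i \oc dsum_pair f = f i.
Proof.
by have /= := mxmE (dsum_unit Y) D (fun _ i => f i) tt i; rewrite compm1.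
Qed.

End Copair.

Section Residues.
Variables (m : nat) (m_gt0 : (0 < m)%N).
Implicit Types (i j : 'I_m) (t u l : int).

Lemma residue l : exists i t, l = i%:Z + t * m%:Z.
Proof.
have m0 : m%:Z != 0 by rewrite eqz_nat -lt0n.
have lt : (`|(l %% m%:Z)%Z| < m)%N.
  by rewrite -ltz_nat gez0_abs ?modz_ge0 // ltz_pmod.
exists (Ordinal lt), (l %/ m%:Z)%Z.
by rewrite /= gez0_abs ?modz_ge0 // addrC -divz_eq.
Qed.

Lemma residue_unique i j t u :
  i%:Z + t * m%:Z = j%:Z + u * m%:Z -> i = j /\ t = u.
Proof.
move=> e; have eij : i = j.
  have := congr1 (fun x => (x %% m%:Z)%Z) e.
  rewrite !(addrC _ (_ * _)) !modzMDl !modz_nat => -[].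
  by rewrite !modn_small // => /val_inj.
split=> //; move: e; rewrite eij => /addrI /mulIf; apply.
by rewrite eqz_nat -lt0n.
Qed.

(** The carry [c] is [1] for the step from [m - 1] to [0] and [0] otherwise. *)
Lemma succm_carry i j : succm i j ->
  exists c : int, forall t, j%:Z + (t + c) * m%:Z = i%:Z + t * m%:Z + 1.
Proof.
move=> /eqP ->; exists (i.+1 %/ m)%N%:Z => t /=.
have := divn_eq i.+1 m; lia.
Qed.

End Residues.

Section Compression.
Variables (k : comPzRingType) (A : kcat k) (addA : is_additive A) (m : nat).
Variable m_gt0 : (0 < m)%N.
Variable X : Cb A.
Let Xc := bcomplex X.
Let F := compression_complex addA m X.
Let DF := compression_dsum addA X : forall i : 'I_m, _.
Implicit Types (i j : 'I_m) (t u l : int).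

Lemma compression_diff_inj i j t u :
  j%:Z + u * m%:Z = i%:Z + t * m%:Z + 1 ->
  diff F i j \oc inj (DF i) t = inj (DF j) u \oc diff Xc _ _.
Proof.
move=> e; apply: (dsum_extl (D := DF j)) => v; rewrite !compA.
rewrite [LHS](mxmE (DF i) (DF j)).
case: (eqVneq u v) => [<-|ne]; first by rewrite (prj_inj (DF j) u) comp1m.
rewrite (prj_inj0 (DF j) ne) comp0m diff_shape //.
rewrite /succz -e; apply: contra_neqN ne => /eqP /(residue_unique m_gt0).
by case.
Qed.

Lemma prj_compression_diff i j t u :
  j%:Z + u * m%:Z = i%:Z + t * m%:Z + 1 ->
  prj (DF j) u \oc diff F i j = diff Xc _ _ \oc prj (DF i) t.
Proof.
move=> e; apply: (dsum_extr (D := DF i)) => v; rewrite -[RHS]compA.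
rewrite [LHS](mxmE (DF i) (DF j)).
case: (eqVneq v t) => [->|ne]; first by rewrite (prj_inj (DF i) t) compm1.
rewrite (prj_inj0 (DF i) ne) compm0 diff_shape //.
rewrite /succz e; apply: contra_neqN ne => /eqP /addIr /(residue_unique m_gt0).
by case.
Qed.

(** Compression does not change the total object: [T] is also the direct sum of
    the objects of the compression of [X], so that endomorphisms of the
    compression become endomorphisms of [T] commuting with its differential. *)

Variables (T : A) (D : dsum (fun l => Xc l) T).

Definition total_inj i : hom (F i) T :=
  dsum_copair (DF i) (fun t => inj D (i%:Z + t * m%:Z)).
Definition total_prj i : hom T (F i) :=
  dsum_pair (DF i) (fun t => prj D (i%:Z + t * m%:Z)).

Lemma total_inj_inj i t : total_inj i \oc inj (DF i) t = inj D (i%:Z + t * m%:Z).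
Proof. exact: (dsum_copair_inj (DF i) (fun t => inj D (i%:Z + t * m%:Z))). Qed.

Lemma prj_total_prj i t : prj (DF i) t \oc total_prj i = prj D (i%:Z + t * m%:Z).
Proof. exact: (prj_dsum_pair (DF i) (fun t => prj D (i%:Z + t * m%:Z))). Qed.

Lemma total_prj_inj i : total_prj i \oc total_inj i = idm (F i).
Proof.
apply: (dsum_extr (D := DF i)) => t; apply: (dsum_extl (D := DF i)) => u.
rewrite compA (compA (prj _ u)) prj_total_prj -(compA (prj D _)) total_inj_inj comp1m.
case: (eqVneq t u) => [->|ne]; first by rewrite (prj_inj (DF i) u) prj_inj.
rewrite (prj_inj0 (DF i) ne) (prj_inj0 D) //.
by apply: contra_neq ne => /(residue_unique m_gt0) [].
Qed.

Lemma total_prj_inj0 i j : i != j -> total_prj j \oc total_inj i = 0.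
Proof.
move=> ne; apply: (dsum_extr (D := DF i)) => t; apply: (dsum_extl (D := DF j)) => u.
rewrite compA (compA (prj _ u)) prj_total_prj -(compA (prj D _)) total_inj_inj.
rewrite comp0m compm0 (prj_inj0 D) //.
by apply: contra_neq ne => /(residue_unique m_gt0) [].
Qed.

Lemma sum_total_inj_prj : \sum_i total_inj i \oc total_prj i = idm T.
Proof.
apply: (dsum_extr (D := D)) => l; have [i [t ->]] := residue m_gt0 l.
rewrite comp_suml (bigD1 i) //= big1 ?addr0 => [|j ji].
  by rewrite -total_inj_inj -compA (compA (total_prj i)) total_prj_inj !comp1m.
by rewrite -total_inj_inj -compA (compA (total_prj j)) total_prj_inj0 1?eq_sym //
  comp0m compm0.
Qed.

Definition total_dsum : dsum (fun i => F i) T :=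
  dsum_of_fin total_prj_inj total_prj_inj0 sum_total_inj_prj.

Definition total_diff : endo T := mxm total_dsum total_dsum (diff F).

Definition total (y : endo (F : Cper A m)) : endo T :=
  diagm total_dsum total_dsum (fun i => (y : chmap F F) i).

Lemma total_diffE l l' : prj D l' \oc total_diff \oc inj D l = diff Xc l l'.
Proof.
have [i [t ->]] := residue m_gt0 l; have [j [u ->]] := residue m_gt0 l'.
rewrite -total_inj_inj -prj_total_prj compA -!(compA (prj (DF j) u)).
rewrite (mxmE total_dsum total_dsum) compA.
exact: (mxmE (DF i) (DF j) (fun t u => diff Xc _ _)).
Qed.

Lemma total_diagE y i t :
  entry D (total y) (i%:Z + t * m%:Z) (i%:Z + t * m%:Z) =
  prj (DF i) t \oc (y : chmap F F) i \oc inj (DF i) t.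
Proof.
rewrite /entry -total_inj_inj -prj_total_prj compA -!(compA (prj (DF i) t)).
have := prj_diagm total_dsum total_dsum (fun i => (y : chmap F F) i) i.
by rewrite /= => ->; rewrite -(compA _ (total_prj i)) total_prj_inj compm1.
Qed.

Lemma total_comm y : total y * total_diff = total_diff * total y.
Proof.
apply: (dsum_extr (D := total_dsum)) => i; apply: (dsum_extl (D := total_dsum)) => j.
have yi := diagm_inj total_dsum total_dsum (fun i => (y : chmap F F) i) i.
have yj := prj_diagm total_dsum total_dsum (fun i => (y : chmap F F) i) j.
have dd := mxmE total_dsum total_dsum (diff F).
rewrite !endoM /total -(compA total_diff) yi !compA yj.
rewrite -(compA _ (prj total_dsum j)) -(compA _ (_ \oc _)) /total_diff !dd.
exact/esym/chmP.
Qed.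

Lemma totalM0 y z : y * z = 0 -> total y * total z = 0.
Proof.
move=> yz; apply: (dsum_extr (D := total_dsum)) => i.
have yi w := diagm_inj total_dsum total_dsum (fun i => (w : chmap F F) i) i.
rewrite endoM comp0m -compA /total yi compA yi -compA.
have /= -> := congr1 (fun f : chmap F F => f i) yz.
by rewrite compm0.
Qed.

Lemma total_eq0 y : total y = 0 -> y = 0.
Proof.
move=> y0; apply: degree_inj => i.
have := diagm_inj total_dsum total_dsum (fun i => (y : chmap F F) i) i.
rewrite -/(total y) y0 comp0m => /(congr1 (fun f => prj total_dsum i \oc f)).
by rewrite compm0 compA prj_inj comp1m => e; exact: esym e.
Qed.

End Compression.

Section Retract.
Variables (k : comPzRingType) (A : kcat k) (m : nat).

Definition lies_over (l : int) (i : 'I_m) := exists t : int, l = i%:Z + t * m%:Z.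

(** [X] is a direct summand of the complex obtained by unrolling [Z].  The maps
    between [X^l] and [Z^i] are given for all pairs [l], [i], so that no
    transport along [l mod m = i] is needed. *)
Definition unrolled_retract (X : complex A succz) (Z : complex A (@succm m)) :=
  exists (h : forall l i, hom (X l) (Z i)) (g : forall i l, hom (Z i) (X l)),
    [/\ forall l l' i j, succz l l' -> lies_over l i -> lies_over l' j ->
          diff Z i j \oc h l i = h l' j \oc diff X l l',
        forall l l' i j, succz l l' -> lies_over l i -> lies_over l' j ->
          diff X l l' \oc g i l = g j l' \oc diff Z i j &
        forall l i, lies_over l i -> g i l \oc h l i = idm (X l)].

Lemma lies_over_refl (i : 'I_m) t : lies_over (i%:Z + t * m%:Z) i.
Proof. by exists t. Qed.

Variables (addA : is_additive A) (flA : hom_finite A) (m_gt0 : (0 < m)%N).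
Variables (X : Cb A) (Z : Cper A m).
Let Xc := bcomplex X.
Let Zc : complex A (@succm m) := Z.
Let F := compression_complex addA m X.
Let DF := compression_dsum addA X : forall i : 'I_m, _.

(** On bounded complexes, compression is adjoint to unrolling on both sides; these
    are the adjoints of the two maps of the retraction. *)
Lemma unrolled_retract_compression : unrolled_retract Xc Zc ->
  exists (phi : chmap F Zc) (psi : chmap Zc F), forall (i : 'I_m) t,
    prj (DF i) t \oc (psi i \oc phi i) \oc inj (DF i) t = idm _.
Proof.
move=> [h [g [hP gP gh]]].
pose phi i := dsum_copair (DF i) (fun t => h (i%:Z + t * m%:Z) i).
pose psi i := dsum_pair (DF i) (fun t => g i (i%:Z + t * m%:Z)).
have phi_inj i t : phi i \oc inj (DF i) t = h (i%:Z + t * m%:Z) i.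
  exact: (dsum_copair_inj (DF i) (fun t => h (i%:Z + t * m%:Z) i)).
have prj_psi i t : prj (DF i) t \oc psi i = g i (i%:Z + t * m%:Z).
  exact: (prj_dsum_pair (DF i) (fun t => g i (i%:Z + t * m%:Z))).
have phiP i j : diff Zc i j \oc phi i = phi j \oc diff F i j.
  have [sij|nij] := boolP (succm i j); last by rewrite !diff_shape // comp0m compm0.
  have [c carry] := succm_carry m_gt0 sij.
  apply: (dsum_extr (D := DF i)) => t; rewrite -!compA phi_inj.
  rewrite (compression_diff_inj addA m_gt0 X (carry t)) compA phi_inj.
  by apply: hP; [rewrite /succz carry| |]; rewrite ?eqxx //; exact: lies_over_refl.
have psiP i j : diff F i j \oc psi i = psi j \oc diff Zc i j.
  have [sij|nij] := boolP (succm i j); last by rewrite !diff_shape // comp0m compm0.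
  have [c carry] := succm_carry m_gt0 sij.
  apply: (dsum_extl (D := DF j)) => u; rewrite -(subrK c u) !compA prj_psi.
  rewrite (prj_compression_diff addA m_gt0 X (carry (u - c))) -compA prj_psi.
  by apply: gP; [rewrite /succz carry| |]; rewrite ?eqxx //; exact: lies_over_refl.
exists (ChMap (X := F) (Y := Zc) phi phiP), (ChMap (X := Zc) (Y := F) psi psiP) => i t /=.
rewrite compA -(compA _ (phi i)) phi_inj prj_psi; apply: gh.
exact: lies_over_refl.
Qed.

(** The composite [c] of the two maps is the identity up to endomorphisms of the
    total object of nonzero degree, hence injective, hence bijective by Fitting's
    lemma; so the compression of [X] is a nonzero direct summand of [Z]. *)
Lemma unrolled_retract_isomorphic : unrolled_retract Xc Zc ->
  ~ is_zero (Xc : complexes A succz) ->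
  idempotents_trivial (Xc : complexes A succz) -> idempotents_trivial Z ->
  Z ~=~ compression addA m X.
Proof.
move=> retr nzX trivX trivZ.
have [phi [psi diag]] := unrolled_retract_compression retr.
pose c : endo (F : Cper A m) := chm_comp psi phi.
have [s Xs] := bounded_finitely_supported (svalP X).
have [T [D]] := dsum_exists addA Xs.
have cancel_c y : c * y = 0 -> y = 0.
  move=> cy; apply: (@total_eq0 k A addA m m_gt0 X T D y).
  apply: (chain_cancel (total_diffE addA m_gt0 D) (svalP X) nzX trivX flA
     (total_comm m_gt0 D c) (total_comm m_gt0 D y)); last exact: totalM0.
  move=> l; have [i [t ->]] := residue m_gt0 l.
  by rewrite total_diagE; exact: diag.
have cancel_cX n y : c ^+ n * y = 0 -> y = 0.
  elim: n => [|n IHn]; first by rewrite mul1r.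
  by rewrite exprS -mulrA => /cancel_c.
have [|n [e [ee ce isoc]]] := fitting_idempotent c flA.
  by exists (enum 'I_m) => i; rewrite mem_enum.
have [w [wc cw]] : is_iso c.
  apply: isoc; apply/esym/eqP; rewrite -subr_eq0; apply/eqP/(cancel_cX n).
  by rewrite mulrBr mulr1 ce subrr.
pose psi' : @hom k (Cper A m) Z F := w \oc (psi : @hom k (Cper A m) Z F).
pose phi' : @hom k (Cper A m) F Z := phi.
have e1 : psi' \oc phi' = idm (F : Cper A m) by rewrite -compA; exact: wc.
exists psi'; exists phi'; split; last exact: e1.
case: (trivZ (phi' \oc psi')) => [|f0|//].
  by rewrite endoM compA -(compA phi') e1 compm1.
case: nzX; apply/complex_is_zero => l; have [i [t ->]] := residue m_gt0 l.
apply/is_zeroP; rewrite -(diag i t).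
have F0 := retract0 e1 f0.
have -> : chm psi i \oc chm phi i = 0; last by rewrite compm0 comp0m.
rewrite -[LHS]compm1.
by have /(congr1 (fun f : chmap F F => f i)) /= -> := F0; rewrite compm0.
Qed.

End Retract.

(** * Shifts *)

Section Transport.
Variables (k : comPzRingType) (A : kcat k) (J : eqType) (F : J -> A).

(** The value [0] for [i <> j] makes transport total, so that it can be composed
    without mentioning equality proofs. *)
Definition transport (i j : J) : hom (F i) (F j) :=
  if i =P j is ReflectT e then
    ecast z (hom (F i) (F z)) e (idm (F i))
  else 0.

Lemma transport_refl i : transport i i = idm (F i).
Proof. by rewrite /transport; case: eqP => // e; rewrite (eq_axiomK e). Qed.

Lemma transportK i j : i = j -> transport j i \oc transport i j = idm (F i).
Proof. by move=> <-; rewrite transport_refl comp1m. Qed.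

End Transport.

Section Shift.
Variables (k : comPzRingType) (A : kcat k).

Lemma diff_transport (I : eqType) (r : rel I) (X : complex A r) i j i' j' :
  i = i' -> j = j' ->
  diff X i' j' \oc transport X i i' = transport X j j' \oc diff X i j.
Proof. by move=> <- <-; rewrite !transport_refl comp1m compm1. Qed.

(** Each degree of [X] has the form [i + t]; evaluating [g] only at such indices
    keeps transports out of the statement. *)
Lemma unshift_ex (t : int) (X : complex A succz) (f : chmap (cshift t X) (cshift t X)) :
  exists g : chmap X X, forall i, g (i + t) = f i.
Proof.
pose g i : hom (X i) (X i) :=
  transport X (i - t + t) i \oc f (i - t) \oc transport X i (i - t + t).
have gE i : g (i + t) = f i.
  rewrite /g; have : i + t - t = i by rewrite addrK.
  by move: (_ - t) => j ->; rewrite !transport_refl comp1m compm1.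
have gP i j : diff X i j \oc g i = g j \oc diff X i j.
  rewrite -(subrK t i) -(subrK t j) !gE; move: (i - t) (j - t) => {}i {}j.
  have -> : diff X (i + t) (j + t) = (-1) ^+ `|t|%N *: diff (cshift t X) i j.
    by rewrite /= scalerA -expr2 sqrr_sign scale1r.
  by rewrite compZl compZr; congr (_ *: _); exact: (chmP f i j).
by exists (ChMap g gP).
Qed.

Lemma shift_idempotents_trivial (t : int) (X : complex A succz) :
  idempotents_trivial (X : complexes A succz) ->
  idempotents_trivial (cshift t X : complexes A succz).
Proof.
move=> trivX e ee; have [g gE] := unshift_ex e.
have gg : (g : endo (X : complexes A succz)) * g = g.
  apply: degree_inj => i; rewrite -(subrK t i) degreeM /degree !gE.
  exact: (congr1 (fun f : endo (cshift t X : complexes A succz) => degree f (i - t)) ee).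
case: (trivX g gg) => E; [left|right]; apply: degree_inj => i; rewrite /degree -gE E //.
Qed.

Lemma shift_is_zero (t : int) (X : complex A succz) :
  is_zero (cshift t X : complexes A succz) -> is_zero (X : complexes A succz).
Proof.
move=> /complex_is_zero z; apply/complex_is_zero => i.
by have := z (i - t); rewrite /= subrK.
Qed.

(** Translation by [p = q m] does not affect residues modulo [m].  The shifts by
    [t] and by [r] multiply the differential by different signs when [p] is odd,
    which the alternating signs [(-1)^(p l)] compensate. *)
Lemma unrolled_retract_shift (m : nat) (S Y : complex A succz)
    (Z : complex A (@succm m)) (t q r : int) :
  unrolled_retract S Z -> t = q * m%:Z + r ->
  (S : complexes A succz) ~=~ cshift t Y -> unrolled_retract (cshift r Y) Z.
Proof.
move=> [h [g [hP gP gh]]] tE [f [f' [f'f ff']]].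
have f'fE l : chm f' l \oc chm f l = idm _ := congr1 (fun a : chmap S S => a l) f'f.
have ff'E l : chm f l \oc chm f' l = idm _ :=
  congr1 (fun a : chmap (cshift t Y) (cshift t Y) => a l) ff'.
pose p := q * m%:Z; pose sgn l : k := (-1) ^+ (`|p| * `|l|)%N.
have sgn2 l : sgn l * sgn l = 1 by rewrite -expr2 sqrr_sign.
have odd_succ l : odd `|(l + 1)%R|%N = ~~ odd `|l|%N by lia.
have odd_t : odd `|t|%N = odd `|p|%N (+) odd `|r|%N by rewrite tE -/p; lia.
have sgnS l : sgn l * (-1) ^+ `|t|%N = sgn (l + 1) * (-1) ^+ `|r|%N.
  rewrite /sgn -!exprD -signr_odd -[RHS]signr_odd !oddD !oddM odd_succ odd_t.
  by do 3!case: (odd _).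
have sgnS' l : (-1) ^+ `|r|%N * sgn l = sgn (l + 1) * (-1) ^+ `|t|%N.
  rewrite /sgn -!exprD -signr_odd -[RHS]signr_odd !oddD !oddM odd_succ odd_t.
  by do 3!case: (odd _).
have over l (i : 'I_m) : lies_over l i -> lies_over (l - p) i.
  by move=> [u ->]; exists (u - q); rewrite /p; lia.
have idx l : l + r = l - p + t by rewrite tE /p; lia.
pose a l : hom (cshift r Y l) (S (l - p)) :=
  sgn l *: (chm f' (l - p) \oc transport Y (l + r) (l - p + t)).
pose b l : hom (S (l - p)) (cshift r Y l) :=
  sgn l *: (transport Y (l - p + t) (l + r) \oc chm f (l - p)).
have ba l : b l \oc a l = idm _.
  rewrite compZl compZr scalerA sgn2 scale1r compA -(compA _ (chm f _)) ff'E.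
  by rewrite compm1; exact: (transportK Y (idx l)).
have aP l : diff S (l - p) (l + 1 - p) \oc a l = a (l + 1) \oc diff (cshift r Y) l (l + 1).
  rewrite compZl !compZr [RHS]scalerA -sgnS -scalerA; congr (_ *: _).
  rewrite compA (chmP f') -!compA compZl compZr; congr (_ *: (_ \oc _)).
  exact: (diff_transport Y (idx l) (idx (l + 1))).
have bP l : diff (cshift r Y) l (l + 1) \oc b l = b (l + 1) \oc diff S (l - p) (l + 1 - p).
  rewrite !compZl compZr scalerA sgnS' -scalerA; congr (_ *: _).
  rewrite -compA -(chmP f) compZl compZr !compA; congr (_ *: (_ \oc _)).
  exact: (diff_transport Y (esym (idx l)) (esym (idx (l + 1)))).
exists (fun l i => h (l - p) i \oc a l), (fun i l => b l \oc g i (l - p)); split.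
- move=> l l' i j /eqP -> /over oi /over oj.
  rewrite compA (hP (l - p) (l + 1 - p) i j) //; last by rewrite /succz addrAC.
  by rewrite -!compA aP.
- move=> l l' i j /eqP -> /over oi /over oj.
  rewrite compA bP -!compA (gP (l - p) (l + 1 - p) i j) //.
  by rewrite /succz addrAC.
- by move=> l i /over oi; rewrite compA -(compA (b l)) gh // compm1.
Qed.

End Shift.

(** * Truncation of the unrolled complex *)

Section Truncation.
Variables (k : comPzRingType) (A : kcat k) (addA : is_additive A).
Variables (m : nat) (m_gt0 : (0 < m)%N) (Z : complex A (@succm m)) (W : pred int).

(** [Y] is the brutal truncation of the unrolled complex to the window [W].  A
    summand of [Y] is a summand of the unrolled complex as soon as the components
    of the differential that leave or enter the window do not meet it. *)
Lemma truncation_ex : exists Y : complex A succz,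
  [/\ forall l, ~~ W l -> is_zero (Y l),
      forall l (i : 'I_m), W l -> lies_over l i -> is_zero (Y l) -> is_zero (Z i) &
      forall (S : complex A succz) (s : chmap S Y) (p : chmap Y S),
        (forall l, p l \oc s l = idm (S l)) ->
        (forall l, W l -> ~~ W (l + 1) -> is_zero (S l)) ->
        (forall l, ~~ W l -> W (l + 1) -> is_zero (S (l + 1))) ->
        unrolled_retract S Z].
Proof.
have [O zO] := zero_exists addA.
pose res l := projT1 (cid (residue m_gt0 l)).
have resP l : lies_over l (res l) := projT2 (cid (residue m_gt0 l)).
have res_eq l i : lies_over l i -> res l = i.
  move=> [t e]; have [u e'] := resP l.
  by have [] := residue_unique m_gt0 (etrans (esym e') e).
pose dP l l' : hom (Z (res l)) (Z (res l')) :=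
  if succz l l' then diff Z (res l) (res l') else 0.
have dPE l l' : succz l l' -> dP l l' = diff Z (res l) (res l') by rewrite /dP => ->.
have dPdP l l' l2 : dP l' l2 \oc dP l l' = 0.
  by rewrite /dP; do 2!case: ifP => _; rewrite ?diff_diff ?comp0m ?compm0.
pose Y l := if W l then Z (res l) else O.
pose cin l : hom (Y l) (Z (res l)) :=
  if W l as b return hom (if b then Z (res l) else O) (Z (res l))
  then idm _ else 0.
pose cpr l : hom (Z (res l)) (Y l) :=
  if W l as b return hom (Z (res l)) (if b then Z (res l) else O)
  then idm _ else 0.
have YW l : ~~ W l -> is_zero (Y l) by rewrite /Y => /negbTE ->.
have pi l : cpr l \oc cin l = idm (Y l).
  by rewrite /cpr /cin /Y; case: (W l); [rewrite comp1m|exact: is_zero_eql zO].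
have ip l : W l -> cin l \oc cpr l = idm _.
  by rewrite /cpr /cin /Y; case: (W l) => // _; rewrite comp1m.
pose dY l l' := cpr l' \oc dP l l' \oc cin l.
have dY_shape l l' : ~~ succz l l' -> dY l l' = 0.
  by rewrite /dY /dP => /negbTE ->; rewrite compm0 comp0m.
have dYdY l l' l2 : dY l' l2 \oc dY l l' = 0.
  have [Wl'|/YW z] := boolP (W l'); last first.
    by rewrite (is_zero_eqr (dY l l') 0 z) compm0.
  rewrite /dY !compA -(compA _ (cin l')) ip // compm1 -(compA (cpr l2)) dPdP.
  by rewrite compm0 comp0m.
exists (Complex Y dY dY_shape dYdY); split => //.
  move=> l i Wl /res_eq <- /is_zeroP Y0; apply/is_zeroP.
  by rewrite -(comp1m (idm _)) -ip // -(compm1 (cin l)) Y0 compm0 !comp0m.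
move=> S s p ps right left.
exists (fun l i => transport Z (res l) i \oc cin l \oc chm s l),
  (fun i l => chm p l \oc cpr l \oc transport Z i (res l)); split.
- move=> l l' i j sl /res_eq <- /res_eq <-; rewrite !transport_refl !comp1m -dPE //.
  rewrite -[RHS]compA -(chmP s) /= /dY !compA.
  have [Wl'|nWl'] := boolP (W l'); first by rewrite ip // comp1m.
  have zSl : is_zero (S l).
    have [Wl|/YW zl] := boolP (W l).
      by apply: right => //; rewrite -(eqP sl).
    by apply/is_zeroP; rewrite -ps (is_zero_eqr (s l) 0 zl) compm0.
  exact: is_zero_eql zSl.
- move=> l l' i j sl /res_eq <- /res_eq <-; rewrite !transport_refl !compm1 -dPE //.
  rewrite compA (chmP p) /= /dY -!compA.
  have [Wl|nWl] := boolP (W l); first by rewrite ip // compm1.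
  have zSl : is_zero (S l').
    rewrite (eqP sl); have [Wl'|/YW zl] := boolP (W (l + 1)); first exact: left.
    by apply/is_zeroP; rewrite -ps (is_zero_eqr (s (l + 1)) 0 zl) compm0.
  exact: is_zero_eqr zSl.
- move=> l i /res_eq <-; rewrite !transport_refl comp1m compm1.
  by rewrite compA -(compA _ (cpr l)) pi compm1.
Qed.

End Truncation.

(** * Isomorphisms and direct sums *)

Section Isomorphisms.
Variables (k : comPzRingType) (C : kcat k).

Lemma isomorphic_sym (X Y : C) : X ~=~ Y -> Y ~=~ X.
Proof. by move=> [f [g [gf fg]]]; exists g; exists f. Qed.

Lemma is_zero_isomorphic (X Y : C) : is_zero X -> is_zero Y -> X ~=~ Y.
Proof.
by move=> zX zY; exists 0; exists 0; split; [exact: is_zero_eql|exact: is_zero_eql].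
Qed.

Lemma biproduct_isomorphic (X W1 W2 X' W1' W2' : C)
    (i1 : hom W1 X) (p1 : hom X W1) (i2 : hom W2 X) (p2 : hom X W2)
    (i1' : hom W1' X') (p1' : hom X' W1') (i2' : hom W2' X') (p2' : hom X' W2') :
  biproduct i1 p1 i2 p2 -> biproduct i1' p1' i2' p2' ->
  W1 ~=~ W1' -> W2 ~=~ W2' -> X ~=~ X'.
Proof.
move=> bp bp' [f1 [g1 [gf1 fg1]]] [f2 [g2 [gf2 fg2]]].
have half Y V1 V2 Y' V1' V2' (j1 : hom V1 Y) (q1 : hom Y V1) (j2 : hom V2 Y)
    (q2 : hom Y V2) (j1' : hom V1' Y') (q1' : hom Y' V1') (j2' : hom V2' Y')
    (q2' : hom Y' V2') (h1 : hom V1 V1') (h1' : hom V1' V1) (h2 : hom V2 V2')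
    (h2' : hom V2' V2) :
    biproduct j1 q1 j2 q2 -> biproduct j1' q1' j2' q2' ->
    h1' \oc h1 = idm V1 -> h2' \oc h2 = idm V2 ->
    (j1 \oc h1' \oc q1' + j2 \oc h2' \oc q2') \oc
    (j1' \oc h1 \oc q1 + j2' \oc h2 \oc q2) = idm Y.
  move=> b b' e1 e2; have [E1 E2 E] := b; have [E1' E2' _] := b'.
  have z12 := biproduct0 b'; have z21 := biproduct0 (biproduct_sym b').
  rewrite compDl !compDr !compA -!(compA _ q1') -!(compA _ q2').
  rewrite E1' E2' z12 z21 !compm1 !compm0 !comp0m addr0 add0r.
  by rewrite -!(compA _ h1') -!(compA _ h2') e1 e2 !compm1.
exists (i1' \oc f1 \oc p1 + i2' \oc f2 \oc p2).
by exists (i1 \oc g1 \oc p1' + i2 \oc g2 \oc p2'); split; exact: half.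
Qed.

End Isomorphisms.

Lemma functor0 (k : comPzRingType) (A B : kcat k) (F : functor A B) (X Y : A) :
  fmor F (0 : hom X Y) = 0.
Proof.
have := fmor_lin F 1 (0 : hom X Y) 0; rewrite !scale1r addr0 => /esym/eqP.
by rewrite -subr_eq0 addrK => /eqP.
Qed.

Lemma functor_is_zero (k : comPzRingType) (A B : kcat k) (F : functor A B) (X : A) :
  is_zero X -> is_zero (F X).
Proof. by move=> /is_zeroP X0; apply/is_zeroP; rewrite -fmor1 X0 functor0. Qed.

Lemma functor_biproduct (k : comPzRingType) (A B : kcat k) (F : functor A B)
    (X W1 W2 : A) (i1 : hom W1 X) (p1 : hom X W1) (i2 : hom W2 X) (p2 : hom X W2) :
  biproduct i1 p1 i2 p2 ->
  biproduct (fmor F i1) (fmor F p1) (fmor F i2) (fmor F p2).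
Proof.
move=> [e1 e2 e]; split; rewrite -!fmorM ?e1 ?e2 ?fmor1 //.
by have := fmor_lin F 1 (i1 \oc p1) (i2 \oc p2); rewrite !scale1r e fmor1.
Qed.

Lemma complex_biproduct (k : comPzRingType) (A : kcat k) (I : eqType) (r : rel I)
    (W1 W2 : complexes A r) : is_additive A ->
  exists X (i1 : hom W1 X) (p1 : hom X W1) (i2 : hom W2 X) (p2 : hom X W2),
    biproduct i1 p1 i2 p2.
Proof.
move=> addA; pose G b : complex A r := if b then W1 else W2.
have D_ex l := addA bool (fun b => G b l).
pose S l := projT1 (cid (D_ex l)).
pose D l : dsum (fun b => G b l) (S l) :=
  inhabited_witness (projT2 (cid (D_ex l))).
pose d i j := diagm (D i) (D j) (fun b => diff (G b) i j).
have di i j b : d i j \oc inj (D i) b = inj (D j) b \oc diff (G b) i j.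
  exact: (diagm_inj (D i) (D j) (fun b => diff (G b) i j)).
have pd i j b : prj (D j) b \oc d i j = diff (G b) i j \oc prj (D i) b.
  exact: (prj_diagm (D i) (D j) (fun b => diff (G b) i j)).
have d0 i j : ~~ r i j -> d i j = 0.
  move=> nij; apply: (dsum_extr (D := D i)) => b.
  by rewrite di diff_shape // comp0m compm0.
have dd i j l : d j l \oc d i j = 0.
  apply: (dsum_extr (D := D i)) => b.
  by rewrite -compA di compA di -compA diff_diff comp0m compm0.
pose X : complexes A r := Complex S d d0 dd.
pose inc b : @hom k (complexes A r) (G b) X :=
  ChMap (X := G b) (Y := X) (fun l => inj (D l) b) (fun i j => di i j b).
pose pro b : @hom k (complexes A r) X (G b) :=
  ChMap (X := X) (Y := G b) (fun l => prj (D l) b) (fun i j => esym (pd i j b)).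
exists X, (inc true), (pro true), (inc false), (pro false).
split; apply: chmap_ext => l /=.
- exact: prj_inj.
- exact: prj_inj.
- by have [_ _ e] := dsum_biproduct (D l).
Qed.

Lemma Cb_biproduct (k : comPzRingType) (A : kcat k) (W1 W2 : Cb A) : is_additive A ->
  exists X (i1 : hom W1 X) (p1 : hom X W1) (i2 : hom W2 X) (p2 : hom X W2),
    biproduct i1 p1 i2 p2.
Proof.
move=> addA.
have [X [i1 [p1 [i2 [p2 bp]]]]] := complex_biproduct (sval W1) (sval W2) addA.
have bX : bounded (X : complex A succz).
  have [N1 z1] := svalP W1; have [N2 z2] := svalP W2.
  exists (N1 + N2)%N => l lN; apply/is_zeroP.
  have [_ _ e] := bp; have := congr1 (fun f : chmap X X => f l) e.
  rewrite /= => <-.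
  have zl1 : is_zero (sval W1 l) by apply: z1; lia.
  have zl2 : is_zero (sval W2 l) by apply: z2; lia.
  rewrite (is_zero_eqr (chm p1 l) 0 zl1) (is_zero_eqr (chm p2 l) 0 zl2).
  by rewrite !compm0 addr0.
by exists (exist _ X bX), i1, p1, i2, p2.
Qed.

Lemma bounded_retract (k : comPzRingType) (A : kcat k) (W X : complexes A succz)
    (i : hom W X) (p : hom X W) :
  p \oc i = idm W -> bounded (X : complex A succz) -> bounded (W : complex A succz).
Proof.
move=> pi [N zX]; exists N => l /zX zl; apply/is_zeroP.
have := congr1 (fun f : chmap W W => f l) pi; rewrite /= => <-.
by rewrite (is_zero_eqr (chm i l) 0 zl) compm0.
Qed.

Lemma full_sub_splits (k : comPzRingType) (C : kcat k) (P : C -> Prop)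
    (X : full_sub P) (e : endo X) :
  (forall f : endo (sval X), f * f = f -> splits f) ->
  (forall W (i : hom W (sval X)) (p : hom (sval X) W), p \oc i = idm W -> P W) ->
  e * e = e -> splits e.
Proof.
move=> spl PW ee; have [W [i [p [pi ip]]]] := spl e ee.
by exists (exist _ W (PW W i p pi)), i, p.
Qed.

Lemma full_sub_idempotents_trivial (k : comPzRingType) (C : kcat k)
    (P : C -> Prop) (X : full_sub P) :
  idempotents_trivial (sval X) <-> idempotents_trivial X.
Proof. by []. Qed.

(** * Density of the compression functor *)

Section Density.
Variables (k : comPzRingType) (A : kcat k) (addA : is_additive A)
  (flA : hom_finite A) (ksA : krull_schmidt A).

Lemma complex_idempotents_split (I : eqType) (r : rel I) (X : complexes A r)
  (e : endo X) : e * e = e -> splits e.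
Proof.
move=> ee; apply: complex_splits => i; apply: krull_schmidt_splits => //.
by rewrite -degreeM ee.
Qed.

Lemma idempotents_trivial_summand (Y : complexes A succz) (l : int) :
  bounded (Y : complex A succz) -> ~ is_zero ((Y : complex A succz) l) ->
  exists (S : complexes A succz) (i : hom S Y) (p : hom Y S),
    [/\ p \oc i = idm S, idempotents_trivial S & ~ is_zero ((S : complex A succz) l)].
Proof.
move=> /bounded_finitely_supported.
move: Y; apply: (@decomposition_ind _ _ _ _ (fun Y =>
  ~ is_zero ((Y : complex A succz) l) -> exists (S : complexes A succz)
    (i : hom S Y) (p : hom Y S), [/\ p \oc i = idm S, idempotents_trivial S
      & ~ is_zero ((S : complex A succz) l)])) => //.
- exact: complex_idempotents_split.
- by move=> X /complex_is_zero z nz; case: nz.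
- by move=> X _ trivX nz; exists X, (idm X), (idm X); rewrite comp1m.
have sub (X W V : complexes A succz) (i : hom W X) (p : hom X W) :
    p \oc i = idm W -> (exists (S : complexes A succz) (j : hom S W) (q : hom W S),
      [/\ q \oc j = idm S, idempotents_trivial S & ~ is_zero ((S : complex A succz) l)]) ->
    exists (S : complexes A succz) (j : hom S X) (q : hom X S),
      [/\ q \oc j = idm S, idempotents_trivial S & ~ is_zero ((S : complex A succz) l)].
  move=> pi [S [j [q [qj trivS nz]]]]; exists S, (i \oc j), (q \oc p); split => //.
  by rewrite compA -(compA q) pi compm1.
move=> X W1 W2 i1 p1 i2 p2 [e1 e2 e] H1 H2 nz.
have [z1|nz1] := pselect (is_zero ((W1 : complex A succz) l)); last first.
  by apply: (sub _ W1 W1 i1 p1 e1); exact: H1.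
have [z2|nz2] := pselect (is_zero ((W2 : complex A succz) l)); last first.
  by apply: (sub _ W2 W2 i2 p2 e2); exact: H2.
case: nz; apply/is_zeroP; have := congr1 (fun f : chmap X X => f l) e.
rewrite /= => <-.
rewrite (is_zero_eqr (chm p1 l) 0 z1) (is_zero_eqr (chm p2 l) 0 z2).
by rewrite !compm0 addr0.
Qed.

Lemma C1_idempotents_split n (Y : C1 A n) (e : endo Y) : e * e = e -> splits e.
Proof.
apply: full_sub_splits => [{}e ee|W i p pi l /(svalP Y) zl].
  apply: full_sub_splits ee => [|W i p pi]; first exact: complex_idempotents_split.
  exact: bounded_retract pi (svalP (C1_incl Y)).
apply/is_zeroP.
have := congr1 (fun f : chmap (bcomplex W) (bcomplex W) => f l) pi.
rewrite /= => <-; rewrite (is_zero_eqr (chm i l) 0 zl) compm0 //.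
Qed.

Variables (n : nat).
Hypothesis A_window : forall X : Cb A, indecomposable X ->
  exists2 Y : C1 A n, indecomposable Y &
    exists t : int, X ~=~ shift t (C1_incl Y).
Variables (m : nat) (m_gt0 : (0 < m)%N).

Lemma indecomposable_isomorphic_compression (Z : Cper A m) : indecomposable Z ->
  exists2 Zh : C1 A n, indecomposable Zh &
    exists2 t : nat, (t < m)%N &
      Z ~=~ compression addA m (shift t%:Z (C1_incl Zh)).
Proof.
move=> indZ.
have trivZ : idempotents_trivial Z.
  by apply: indecomposable_idempotents_trivial indZ; exact: complex_idempotents_split.
have [i0 nz0] : exists i, ~ is_zero ((Z : complex A (@succm m)) i).
  by apply/existsNP => z; apply: (proj1 indZ); exact/complex_is_zero.
(* A shift of a complex in [1, n] that is nonzero in degree [i0] vanishes in the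
   degrees [i0 - n] and [i0 + n]. *)
pose W : pred int := fun l => (`|l - i0%:Z| <= n)%N.
have [Y [Ysupp Ynz retr]] := truncation_ex addA m_gt0 (Z : complex A (@succm m)) W.
have bY : bounded Y.
  exists (n + m)%N => l lnm; apply: Ysupp; rewrite /W -ltnNge.
  have := ltn_ord i0; lia.
have nzY : ~ is_zero (Y i0%:Z).
  move=> z; apply/nz0/(Ynz i0%:Z i0) => //; first by rewrite /W subrr.
  by exists 0; rewrite mul0r addr0.
have [S [s [p [ps trivS nzS]]]] := idempotents_trivial_summand bY nzY.
have bS := bounded_retract ps bY.
pose Sb : Cb A := exist _ (S : complex A succz) bS.
have nzSb : ~ is_zero Sb.
  move=> /is_zeroP z; have /complex_is_zero zS : is_zero S by exact/is_zeroP.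
  by apply: nzS; exact: zS.
have indS : indecomposable Sb by apply: idempotents_trivial_indecomposable.
have [Yn indYn [t isoS]] := A_window indS.
pose Yc : complex A succz := bcomplex (C1_incl Yn).
have isoS' : (S : complexes A succz) ~=~ cshift t Yc := isoS.
have Swin l : ~~ ((1 <= l + t) && (l + t <= n%:Z)) -> is_zero ((S : complex A succz) l).
  move=> /(svalP Yn) zl; have [f [g [gf _]]] := isoS'; apply/is_zeroP.
  have := congr1 (fun f : chmap S S => f l) gf; rewrite /= => <-.
  by rewrite (is_zero_eqr (chm f l) 0 zl) compm0.
have i0t : (1 <= i0%:Z + t) && (i0%:Z + t <= n%:Z).
  by apply/negPn/negP => /Swin.
have retrS : unrolled_retract S (Z : complex A (@succm m)).
  apply: (retr S s p); first by move=> l; exact: (congr1 (fun f : chmap S S => f l) ps).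
  - by rewrite /W => l Wl nWl; apply: Swin; lia.
  - by rewrite /W => l nWl Wl; apply: Swin; lia.
pose q := (t %/ m%:Z)%Z; pose r := `|(t %% m%:Z)%Z|%N.
have m0 : m%:Z != 0 by rewrite eqz_nat -lt0n.
have rE : r%:Z = (t %% m%:Z)%Z by rewrite /r gez0_abs // modz_ge0.
have rm : (r < m)%N by rewrite -ltz_nat rE ltz_pmod.
have tE : t = q * m%:Z + r%:Z by rewrite rE -divz_eq.
have trivYn : idempotents_trivial (Yc : complexes A succz).
  do 2!apply/full_sub_idempotents_trivial.
  exact: (indecomposable_idempotents_trivial (@C1_idempotents_split n Yn) indYn).
exists Yn => //; exists r => //.
apply: unrolled_retract_isomorphic => //.
- exact: unrolled_retract_shift retrS tE isoS'.
- move=> /shift_is_zero /is_zeroP z; apply: (proj1 indYn); exact/is_zeroP.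
- exact: shift_idempotents_trivial.
Qed.

Lemma compression_dense : is_dense (compression addA m).
Proof.
move=> Z; apply: (@decomposition_ind _ _ _ _ (fun Z : Cper A m =>
  exists X, compression addA m X ~=~ Z)) => //.
- exact: complex_idempotents_split.
- move=> {}Z zZ; have [O zO] := zero_exists addA.
  pose X0 : complex A succz := @Complex _ _ _ succz (fun _ => O) (fun _ _ => 0)
    (fun _ _ _ => erefl) (fun _ _ _ => comp0m _ _).
  have bX0 : bounded X0 by exists 0%N.
  exists (exist _ X0 bX0); apply: is_zero_isomorphic zZ.
  apply: functor_is_zero; apply/is_zeroP; apply: chmap_ext => i.
  exact: is_zero_eql zO.
- move=> {}Z nz triv.
  have indZ : indecomposable Z by exact: idempotents_trivial_indecomposable.
  have [Zh _ [t _ iso]] := indecomposable_isomorphic_compression indZ.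
  by exists (shift t%:Z (C1_incl Zh)); exact: isomorphic_sym.
- move=> {}Z W1 W2 i1 p1 i2 p2 bp [X1 iso1] [X2 iso2].
  have [X [j1 [q1 [j2 [q2 bX]]]]] := Cb_biproduct X1 X2 addA.
  exists X; exact: biproduct_isomorphic (functor_biproduct _ bX) bp iso1 iso2.
- by exists (enum 'I_m) => i; rewrite mem_enum.
Qed.

End Density.

Theorem theorem3p1 (k : comPzRingType) (A : kcat k)
    (A_additive : is_additive A) (A_hom_finite : hom_finite A)
    (A_krull_schmidt : krull_schmidt A)
    (n : nat) (n_ge2 : (2 <= n)%N)
    (A_window : forall X : Cb A, indecomposable X ->
       exists2 Y : C1 A n, indecomposable Y &
         exists t : int, X ~=~ shift t (C1_incl Y))
    (m : nat) (m_gt0 : (0 < m)%N) :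
  (forall Z : Cper A m, indecomposable Z ->
     exists2 Zh : C1 A n, indecomposable Zh &
       exists2 t : nat, (t < m)%N &
         Z ~=~ compression A_additive m (shift t%:Z (C1_incl Zh)))
  /\ is_dense (compression A_additive m).
Proof.
split; first exact: indecomposable_isomorphic_compression.
exact: (compression_dense A_additive A_hom_finite A_krull_schmidt A_window).
Qed.
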